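(* Let $m=0$ and $\omega(x)=\eta(x)=e^{|x|}$. Then $\gamma:=\operatorname*{ess\,sup}_x\left|\frac{\partial_r\omega\cdot\eta-\omega\cdot\partial_r\eta}{\omega}\right|=0$ and $\tau:=\operatorname*{ess\,inf}_x\frac{\eta(x)}{|x|}=e$, and for every $\psi\in C_c^\infty(\mathbb{R}^3\setminus\{0\};\mathbb{C}^4)$, \[ e^2\int_{\mathbb{R}^3}\frac{|\psi|^2}{e^{|x|}}\,dx\le e^2\int_{\mathbb{R}^3}\frac{|(1+2\mathbf{S}\cdot L)\psi|^2}{e^{|x|}}\,dx\le\int_{\mathbb{R}^3}|-i\alpha\cdot\nabla\psi|^2e^{|x|}\,dx . \] Moreover, for every constant vector $v\in\mathbb{R}^4$, the function $\psi_0(x)=v\,\exp\!\big(e^{1-|x|}\big)$ satisfies $\int_{\mathbb{R}^3}|-i\alpha\cdot\nabla\psi_0|^2e^{|x|}\,dx<+\infty$ and \[ e^2\int_{\mathbb{R}^3}\frac{|\psi_0|^2}{e^{|x|}}\,dx= e^2\int_{\mathbb{R}^3}\frac{|(1+2\mathbf{S}\cdot L)\psi_0|^2}{e^{|x|}}\,dx=\int_{\mathbb{R}^3}|-i\alpha\cdot\nabla\psi_0|^2e^{|x|}\,dx , \] i.e. $\psi_0$ attains equality in both inequalities.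
   Context: The Pauli matrices are $\sigma_1=\begin{pmatrix}0&1\\1&0\end{pmatrix}$, $\sigma_2=\begin{pmatrix}0&-i\\ i&0\end{pmatrix}$, $\sigma_3=\begin{pmatrix}1&0\\0&-1\end{pmatrix}$, $\sigma=(\sigma_1,\sigma_2,\sigma_3)$. The Dirac matrices are $\alpha_j=\begin{pmatrix}0&\sigma_j\\ \sigma_j&0\end{pmatrix}$, $j=1,2,3$, and $-i\alpha\cdot\nabla=-i\sum_{j=1}^3\alpha_j\partial_j$ (the massless free Dirac operator). The spin angular momentum operator is $\mathbf{S}=\tfrac12\begin{pmatrix}\sigma&0\\0&\sigma\end{pmatrix}$ (componentwise $\mathbf{S}_k=\tfrac12\mathrm{diag}(\sigma_k,\sigma_k)$), the orbital angular momentum is $L=-i\,x\wedge\nabla$ (acting componentwise on $\mathbb{C}^4$-valued functions), and $\mathbf{S}\cdot L=\sum_{k=1}^3\mathbf{S}_kL_k$. $\partial_r$ is the radial derivative. $|\cdot|$ denotes the Euclidean norm on $\mathbb{C}^4$. *)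

(* Defs.v *)
From HB Require Import structures.
From mathcomp Require Import all_boot all_order all_algebra.
From mathcomp Require Import all_classical all_reals all_analysis.
From mathcomp Require Import complex ess_sup_inf.

Set Implicit Arguments.
Unset Strict Implicit.
Unset Printing Implicit Defensive.

Import Order.TTheory GRing.Theory Num.Theory.
Import numFieldNormedType.Exports.

Local Open Scope ring_scope.
Local Open Scope complex_scope.

Section Dirac.
Variable R : realType.

Definition R3 := ((R * R) * R)%type.

Definition leb3 := ((@lebesgue_measure R \x @lebesgue_measure R)
                      \x @lebesgue_measure R)%E.

Definition coord (x : R3) (j : 'I_3) : R :=
  match val j with 0%N => x.1.1 | 1%N => x.1.2 | _ => x.2 end.

Definition upd (x : R3) (j : 'I_3) (t : R) : R3 :=
  match val j with
  | 0%N => (t, x.1.2, x.2)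
  | 1%N => (x.1.1, t, x.2)
  | _ => (x.1.1, x.1.2, t) end.

Definition nrm (x : R3) : R := Num.sqrt (x.1.1 ^+ 2 + x.1.2 ^+ 2 + x.2 ^+ 2).

Definition partial (j : 'I_3) (f : R3 -> R) (x : R3) : R :=
  derive1 (fun t => f (upd x j t)) (coord x j).

Definition iter_partial (l : seq 'I_3) (f : R3 -> R) : R3 -> R :=
  foldr partial f l.

Definition smooth (f : R3 -> R) : Prop :=
  forall l : seq 'I_3,
    continuous (iter_partial l f) /\
    forall (j : 'I_3) (x : R3),
      derivable (fun t => iter_partial l f (upd x j t)) (coord x j) 1.

Definition radial (f : R3 -> R) (x : R3) : R :=
  derive1 (fun t => f ((1 + t / nrm x) * x.1.1, (1 + t / nrm x) * x.1.2,
                       (1 + t / nrm x) * x.2)) 0.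

Definition spinor := R3 -> 'cV[R[i]]_4.

Definition partialC (j : 'I_3) (f : R3 -> R[i]) (x : R3) : R[i] :=
  (partial j (fun y => complex.Re (f y)) x) +i*
  (partial j (fun y => complex.Im (f y)) x).

Definition partialS (j : 'I_3) (psi : spinor) (x : R3) : 'cV[R[i]]_4 :=
  \col_k partialC j (fun y => psi y k 0) x.

(* Pauli matrices (index j = 0,1,2 stands for sigma_1, sigma_2, sigma_3) *)
Definition sigma (j : 'I_3) : 'M[R[i]]_2 :=
  \matrix_(a < 2, b < 2)
   match val j with
   | 0%N => if a == b then 0 else 1
   | 1%N => if a == b then 0 else if val a == 0%N then - 'i else 'i
   | _ => if a == b then (if val a == 0%N then 1 else -1) else 0
   end.

Definition alpha (j : 'I_3) : 'M[R[i]]_4 := block_mx 0 (sigma j) (sigma j) 0.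

Definition spin (k : 'I_3) : 'M[R[i]]_4 :=
  (2%:R)^-1 *: block_mx (sigma k) 0 0 (sigma k).

Definition dirac (psi : spinor) (x : R3) : 'cV[R[i]]_4 :=
  - 'i *: \sum_(j < 3) (alpha j *m partialS j psi x).

(* orbital angular momentum L = -i x /\ nabla:
   L_k = -i (x_{k+1} d_{k+2} - x_{k+2} d_{k+1}) (indices mod 3) *)
Definition angmom (k : 'I_3) (psi : spinor) (x : R3) : 'cV[R[i]]_4 :=
  let a := (k + 1)%R in let b := (k + 2)%R in
  - 'i *: ((coord x a)%:C *: partialS b psi x - (coord x b)%:C *: partialS a psi x).

Definition spin_orbit (psi : spinor) (x : R3) : 'cV[R[i]]_4 :=
  \sum_(k < 3) (spin k *m angmom k psi x).

Definition spin_orbit_op (psi : spinor) (x : R3) : 'cV[R[i]]_4 :=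
  psi x + 2%:R *: spin_orbit psi x.

Definition norm2 (v : 'cV[R[i]]_4) : R :=
  \sum_(k < 4) (complex.Re (v k 0) ^+ 2 + complex.Im (v k 0) ^+ 2).

Definition test_spinor (psi : spinor) : Prop :=
  (forall k : 'I_4, smooth (fun x => complex.Re (psi x k 0)) /\
                    smooth (fun x => complex.Im (psi x k 0))) /\
  exists a b : R, 0 < a /\
    forall x, (nrm x < a \/ b < nrm x) -> psi x = 0.

Definition omega_w (x : R3) : R := expR (nrm x).
Definition eta_w (x : R3) : R := expR (nrm x).

Definition I_L2 (psi : spinor) : \bar R :=
  (\int[leb3]_x (norm2 (psi x) / expR (nrm x))%:E)%E.
Definition I_SL (psi : spinor) : \bar R :=
  (\int[leb3]_x (norm2 (spin_orbit_op psi x) / expR (nrm x))%:E)%E.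
Definition I_D (psi : spinor) : \bar R :=
  (\int[leb3]_x (norm2 (dirac psi x) * expR (nrm x))%:E)%E.

Definition psi0 (v : 'cV[R]_4) : spinor :=
  fun x => \col_k ((v k 0 * expR (expR (1 - nrm x)))%:C).

End Dirac.

(* Main.v *)
Require Import Defs.
From HB Require Import structures.
From mathcomp Require Import all_boot all_order all_algebra.
From mathcomp Require Import all_classical all_reals all_analysis.
From mathcomp Require Import complex ess_sup_inf measurable_realfun ring lra.

Import Order.TTheory GRing.Theory Num.Theory.
Import numFieldNormedType.Exports.

Local Open Scope ring_scope.

Set Implicit Arguments.
Unset Strict Implicit.
Unset Printing Implicit Defensive.

(* With R = x.nabla and K = 1 + 2 S.L acting on each two-spinor component of psi:
   (i) K^2 = L^2 + sigma.L + 1 up to a divergence, and |sigma.L chi|^2 <= 2 |L chi|^2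
   pointwise because L is tangential, so |K chi|^2 - |chi|^2 integrates against the
   radial weight e^{-r} to something nonnegative;
   (ii) r |sigma.nabla chi| = |(R + 1 - K) chi|, and completing the square gives
   e^r |sigma.nabla chi|^2 >= e^2 e^{-r} |K chi|^2 - 2e <(R + 1) chi, K chi> / r since
   e^r >= e r; the last term is a divergence as K commutes with the operator
   (R + 1) / r, which is skew-adjoint.
   For psi_0, radial and with the derivative making the square vanish, every step is
   an equality. *)

(** The radial weights are singular or not differentiable at the origin, which the supports avoid;
    there 1/0 = 0 keeps the formulas meaningful. As the mass is zero, the Dirac operator exchanges
    the two two-spinors without coupling them, and real and imaginary parts turn the matrix algebra
    into polynomial identities for [ring]. The factor 2 in the tangential bound is exactly what (i)
    can afford: modulo divergences, |K chi|^2 - |chi|^2 is 2 |L chi|^2 - |sigma.L chi|^2. For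
    nonzero v, [psi0 v] is not a test spinor, since it tends to v at infinity, and e r < e^r unless
    r = 1; equality is therefore not read off the chain in (ii). The integrands are shown to
    coincide off the origin, and finiteness follows from the integrability of e^{-r}. *)

Section Measurability.
Variable R : realType.
Local Notation R3 := (R3 R).
Local Notation leb3 := (@leb3 R).
Implicit Types f g : R3 -> R.
Local Open Scope classical_set_scope.

Let ratball (q : (rat * rat * rat) * rat) : set R3 :=
  ball (ratr q.1.1.1 : R, ratr q.1.1.2 : R, ratr q.1.2 : R) (ratr q.2 : R).

Let measurable_ratball q : measurable (ratball q : set (measurableTypeR R * measurableTypeR R * measurableTypeR R)).
Proof.
rewrite (_ : ratball q = (ball (ratr q.1.1.1 : R) (ratr q.2 : R)
   `*` ball (ratr q.1.1.2 : R) (ratr q.2 : R)) `*` ball (ratr q.1.2 : R) (ratr q.2 : R)).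
  by apply: measurableX; [apply: measurableX|]; by rewrite ball_itv; exact: measurable_itv.
by apply/seteqP; split => -[[x y] z] /=.
Qed.

(** The product sigma-algebra is generated by rectangles, so an open set has to be recovered as a
    countable union: balls of the product are cubes, and the rational ones lying in [U] cover it. *)
Lemma measurable_open3 (U : set R3) : open U ->
  measurable (U : set (measurableTypeR R * measurableTypeR R * measurableTypeR R)).
Proof.
move=> oU.
have -> : U = \bigcup_(q : (rat * rat * rat) * rat)
    (if `[< ratball q `<=` U >] then ratball q else set0).
  apply/seteqP; split => [[[x y] z] Ux|p [q _]]; last first.
    by case: ifPn => // /asboolP; exact.
  have /nbhs_ballP[e /= e0 eU] := open_nbhs_nbhs (conj oU Ux).
  (* A radius below e / 2 keeps the rational cube inside the ball of radius [e]; the bound e / 4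
     only makes it positive. *)
  have e2 : e / 4 < e / 2 by rewrite ltr_pM2l// ltf_pV2 ?posrE// ltr_nat.
  have [q] := rat_in_itvoo e2; rewrite in_itv /= => /andP[eq qe].
  have q0 : 0 < ratr q :> R by apply: lt_trans eq; rewrite divr_gt0.
  have near_rat (t : R) : exists u : rat, `|ratr u - t| < ratr q.
    have tq : t - ratr q < t + ratr q by lra.
    have [u] := rat_in_itvoo tq; rewrite in_itv /= => /andP[tu ut].
    by exists u; rewrite ltr_norml; apply/andP; split; lra.
  have [u ux] := near_rat x; have [v vy] := near_rat y; have [w wz] := near_rat z.
  have xin : ratball ((u, v, w), q) (x, y, z).
    by rewrite /ratball /=; split; [split|].
  exists ((u, v, w), q) => //; rewrite asboolT // => p qp; apply: eU.
  apply: (@le_ball _ _ _ (ratr q + ratr q)).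
    by lra.
  by apply: ball_triangle qp; apply: ball_sym.
apply: countable_bigcupT_measurable; first exact: countableP.
by move=> q; case: ifPn.
Qed.

Lemma continuous_measurable3 f : continuous f ->
  measurable_fun setT (f : (measurableTypeR R * measurableTypeR R * measurableTypeR R) -> R).
Proof.
move=> /continuousP cf; apply: (measurability _ (RGenOpens.measurableE R)).
move=> _ [_ [a [b ->] <-]]; rewrite setTI.
by apply: measurable_open3; exact/cf/interval_open.
Qed.

End Measurability.

(** * Integrability of continuous functions supported in a cube *)

Section Integrability.
Local Open Scope classical_set_scope.

Lemma integrable_bounded_support d (T : measurableType d) (R : realType)
    (mu : {measure set T -> \bar R}) (B : set T) (M : R) (f : T -> R) :
  measurable B -> (mu B < +oo)%E -> measurable_fun setT f ->
  (forall x, `|f x| <= M) -> (forall x, ~ B x -> f x = 0) ->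
  mu.-integrable setT (EFin \o f).
Proof.
move=> mB fB mf fM f0.
have <- : ((EFin \o f) \_ B) = EFin \o f.
  apply/funext => x; rewrite /patch; case: ifPn => // xB;
  by rewrite /= f0 //; move: xB; rewrite notin_setE.
apply/(integrable_mkcond _ _).1 => //; apply: measurable_bounded_integrable => //.
  exact: measurable_funTS.
by exists M; split => [|x Mx y _]; [exact: num_real|exact: le_trans (fM y) (ltW Mx)].
Qed.

Definition boxed (R : realType) (b : R) (f : R3 R -> R) :=
  forall x, b < `|x.1.1| \/ b < `|x.1.2| \/ b < `|x.2| -> f x = 0.

Variable R : realType.
Local Notation R3 := (R3 R).
Local Notation leb3 := (@leb3 R).
Local Notation leb := (@lebesgue_measure R).

Let I (b : R) : set R := `[- b, b].

Let Iout (b t : R) : ~ I b t -> b < `|t|.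
Proof. by move/negP; rewrite /I /= in_itv /= -ler_norml -ltNge. Qed.

Let leb_I b : (leb (I b) < +oo)%E.
Proof. by rewrite /I lebesgue_measure_itv /=; case: ifP; rewrite -?EFinB ltry. Qed.

Let leb_I0 b : (leb (I b)) \is a fin_num.
Proof. by rewrite ge0_fin_numE // leb_I. Qed.

Let leb2_box b : ((leb \x leb) (I b `*` I b) < +oo)%E.
Proof.
rewrite [X in (X < _)%E](_ : _ = leb (I b) * leb (I b))%E.
  by rewrite lte_mul_pinfty.
by apply: product_measure1E; exact: measurable_itv.
Qed.

Let leb3_box b : (leb3 ((I b `*` I b) `*` I b) < +oo)%E.
Proof.
rewrite [X in (X < _)%E](_ : _ = (leb \x leb) (I b `*` I b) * leb (I b))%E.
  by rewrite lte_mul_pinfty ?ge0_fin_numE // leb2_box.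
by apply: product_measure1E; [apply: measurableX|]; exact: measurable_itv.
Qed.

Lemma boxed_bounded b (f : R3 -> R) : continuous f -> boxed b f ->
  exists M, forall x, `|f x| <= M.
Proof.
move=> cf bf; pose B := (I b `*` I b) `*` I b.
have cB : compact (B : set R3).
  by apply: compact_setX; [apply: compact_setX|]; exact: segment_compact.
have [M [Mr H]] := compact_bounded (continuous_compact (continuous_subspaceT cf) cB).
exists (`|M| + 1) => x; have [Bx|nBx] := pselect (B x).
  by apply: H; [rewrite (le_lt_trans (ler_norm _)) // ltrDl|exists x].
rewrite bf ?normr0 ?addr_ge0 //.
apply: contrapT => /not_orP[h1 /not_orP[h2 h3]]; apply: nBx.
by split; [split|]; apply: contrapT => /Iout.
Qed.

Lemma integrable_boxed b (f : R3 -> R) : continuous f -> boxed b f ->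
  leb3.-integrable setT (EFin \o f).
Proof.
move=> cf bf; have [M fM] := boxed_bounded cf bf.
apply: (@integrable_bounded_support _ _ _ leb3 ((I b `*` I b) `*` I b) M) => //.
- by apply: measurableX; [apply: measurableX|]; exact: measurable_itv.
- exact: leb3_box.
- exact: continuous_measurable3.
- move=> x nB; apply: bf; apply: contrapT => /not_orP[h1 /not_orP[h2 h3]]; apply: nB.
  by split; [split|]; apply: contrapT => /Iout.
Qed.

(** Fubini yields integrability of almost every slice only; boundedness and bounded support give it
    for every [z]. *)
Lemma integrable_boxed_slice b (f : R3 -> R) z : continuous f -> boxed b f ->
  (leb \x leb)%E.-integrable setT (fun u : R * R => (f (u, z))%:E).
Proof.
move=> cf bf; have [M fM] := boxed_bounded cf bf.
apply: (@integrable_bounded_support _ _ _ (leb \x leb)%E (I b `*` I b) M (fun u => f (u, z))) => //.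
- by apply: measurableX; exact: measurable_itv.
- exact: leb2_box.
- exact: (measurable_fun_pair1 _ (continuous_measurable3 cf)).
- move=> x nB; apply: bf; apply: contrapT => /not_orP[h1 /not_orP[h2 h3]]; apply: nB.
  by split; apply: contrapT => /Iout.
Qed.

End Integrability.

(** * Partial derivatives along coordinate lines *)

Section Coordinates.
Variable R : realType.
Local Notation R3 := (R3 R).
Implicit Types (x : R3) (f g : R3 -> R) (j : 'I_3).

Lemma upd_upd x j s t : upd (upd x j s) j t = upd x j t.
Proof. by case: j => [[|[|[|//]]] ?]. Qed.

Lemma coord_upd x j t : Defs.coord (upd x j t) j = t.
Proof. by case: j => [[|[|[|//]]] ?]. Qed.

Lemma upd_coord x j : upd x j (Defs.coord x j) = x.
Proof. by case: j => [[|[|[|//]]] ?]; case: x => [[]]. Qed.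

Lemma derive1_upd f x j t :
  derive1 (fun s => f (upd x j s)) t = partial j f (upd x j t).
Proof.
rewrite /partial coord_upd; congr (derive1 _ _).
by apply/funext => s; rewrite upd_upd.
Qed.

Lemma upd_continuous x j : continuous (upd x j).
Proof.
have pc (f g : R -> R) (h : R -> R) : continuous f -> continuous g -> continuous h ->
    continuous (fun t => (f t, g t, h t)).
  by move=> cf cg ch t; exact: (cvg_pair (cvg_pair (cf t) (cg t)) (ch t)).
have ci : continuous (fun t : R => t) by move=> t; exact: cvg_id.
have cc (c : R) : continuous (fun t : R => c) by move=> t; exact: cvg_cst.
case: j => [[|[|[|//]]] ?] /=.
- exact: (pc id (fun=> x.1.2) (fun=> x.2)).
- exact: (pc (fun=> x.1.1) id (fun=> x.2)).
- exact: (pc (fun=> x.1.1) (fun=> x.1.2) id).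
Qed.

Definition C1 f := continuous f /\ forall j,
  (forall x, derivable (fun t => f (upd x j t)) (Defs.coord x j) 1)
  /\ continuous (partial j f).

Lemma derivable_upd f x j t :
  (forall x, derivable (fun t => f (upd x j t)) (Defs.coord x j) 1) ->
  derivable (fun s => f (upd x j s)) t 1.
Proof.
move=> /(_ (upd x j t)); rewrite coord_upd.
by under [fun _ => f (upd (upd _ _ _) _ _)]eq_fun do rewrite upd_upd.
Qed.

Lemma partial_near f g j x :
  (\forall t \near Defs.coord x j, f (upd x j t) = g (upd x j t))%classic ->
  partial j f x = partial j g x.
Proof. by move=> fg; rewrite /partial !derive1E; exact: near_eq_derive. Qed.

Lemma partial_cst j (c : R) x : partial j (cst c) x = 0.
Proof. by rewrite /partial derive1_cst. Qed.

Lemma boxed_partial b j f : boxed b f -> boxed b (partial j f).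
Proof.
move=> bf x bx; rewrite -(partial_cst j 0 x); apply: partial_near.
have gtP (u : R) : b < `|u| -> (\forall t \near u, b < `|t|)%classic.
  by move=> bu; apply: (cvgr_gt _ (@norm_continuous _ _ u)).
case: j => [[|[|[|//]]] lt3]; case: bx => [h|[h|h]];
  by [apply: filterE => t; apply: bf => /=; tauto
     |apply: filterS (gtP _ h) => t h'; apply: bf => /=; tauto].
Qed.

End Coordinates.

(* The library's canonical sigma-finite structure on a product of measures only
   covers products of subprobabilities, so the one on R^2 is declared here. *)
Definition leb2 (R : realType) :
    set (measurableTypeR R * measurableTypeR R) -> \bar R :=
  (@lebesgue_measure R \x @lebesgue_measure R)%E.

Section Leb2.
Variable R : realType.
Local Notation leb2 := (@leb2 R).
Local Open Scope classical_set_scope.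

HB.instance Definition _ := Measure.on leb2.

Let leb2_sigma_finite : sigma_finite setT leb2.
Proof.
have /sigma_finiteP[F [TF ndF Foo]] := sigma_finiteT (@lebesgue_measure R).
exists (fun n => F n `*` F n).
  rewrite -setXTT TF predeqE => -[x y]; split.
    move=> [/= [n _ Fnx] [k _ Fky]]; exists (maxn n k) => //; split.
      by move: x Fnx; exact/subsetPset/ndF/leq_maxl.
    by move: y Fky; exact/subsetPset/ndF/leq_maxr.
  by move=> [n _ []/= ? ?]; split; exists n.
move=> k; have [mF Foo'] := Foo k; split; first exact: measurableX.
rewrite [X in (X < _)%E](_ : _ = lebesgue_measure (F k) * lebesgue_measure (F k))%E.
  by rewrite lte_mul_pinfty // ge0_fin_numE.
exact: product_measure1E.
Qed.

HB.instance Definition _ := Measure_isSigmaFinite.Build _ _ _ leb2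
  leb2_sigma_finite.

Lemma leb3_iterated21 (f : R3 R -> \bar R) : (@leb3 R).-integrable setT f ->
  (\int[@leb3 R]_x f x = \int[@lebesgue_measure R]_z \int[leb2]_u f (u, z))%E.
Proof.
move=> h.
exact: (esym (@integral21_prod_meas1 _ _ _ _ R leb2 (@lebesgue_measure R) f h)).
Qed.

Lemma leb3_iterated12 (f : R3 R -> \bar R) : (@leb3 R).-integrable setT f ->
  (\int[@leb3 R]_x f x = \int[leb2]_u \int[@lebesgue_measure R]_z f (u, z))%E.
Proof.
move=> h.
exact: (esym (@integral12_prod_meas1 _ _ _ _ R leb2 (@lebesgue_measure R) f h)).
Qed.

End Leb2.

(** * Vanishing integral of a partial derivative *)

Section Divergence.
Variable R : realType.
Local Notation R3 := (R3 R).
Local Notation leb3 := (@leb3 R).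
Local Notation leb := (@lebesgue_measure R).
Local Open Scope classical_set_scope.

Lemma integral_derive1_support (b : R) (g : R -> R) :
  (forall t, derivable g t 1) -> continuous (derive1 g) ->
  (forall t, b < `|t| -> g t = 0) ->
  (\int[leb]_t (derive1 g t)%:E = 0)%E.
Proof.
(* [c] is positive and exceeds [b]: the interval from [- c] to [c] is nondegenerate, as the
   fundamental theorem of calculus requires, and [g] vanishes at both ends. *)
move=> dg cg g0; pose c : R := `|b| + 1.
have bc : b < c by rewrite (le_lt_trans (ler_norm b)) // ltrDl.
have c0 : 0 < c by rewrite ltr_wpDl.
have nc : - c < c by rewrite gtrN.
have -> : (\int[leb]_t (derive1 g t)%:E = \int[leb]_(t in `[(- c)%R, c]) (derive1 g t)%:E)%E.
  rewrite [RHS]integral_mkcond; apply: eq_integral => t _; rewrite /patch.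
  case: ifPn => //; rewrite notin_setE /= in_itv /= => /negP.
  rewrite -ler_norml -ltNge => ct.
  rewrite derive1E (@near_eq_derive _ _ _ g (cst 0)) ?derive_cst //.
  have : \forall s \near t, b < `|s|.
    by apply: (cvgr_gt _ (@norm_continuous _ _ t)); exact: lt_trans ct.
  by apply: filterS => s /g0 ->.
have cg' : continuous g.
  by move=> t; apply: differentiable_continuous; apply/derivable1_diffP.
rewrite (@continuous_FTC2 _ (derive1 g) g _ _ nc).
- by rewrite !g0 ?subee // ?normrN ger0_norm // ltW.
- exact: continuous_subspaceT.
- split; first by [].
    by apply: cvg_at_right_filter; exact: cg'.
  by apply: cvg_at_left_filter; exact: cg'.
- by [].
Qed.

(** Fubini with the [j]-th variable innermost: every line integral vanishes by the fundamental
    theorem of calculus. *)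
Lemma integral_partial (b : R) j f : C1 f -> boxed b f ->
  (\int[leb3]_x (partial j f x)%:E = 0)%E.
Proof.
move=> [cf] /(_ j)[df cdf] bf.
have bdf := boxed_partial j bf.
have idf := integrable_boxed cdf bdf.
have slice x : (\int[leb]_t (partial j f (upd x j t))%:E = 0)%E.
  under eq_integral do rewrite -derive1_upd.
  apply: (@integral_derive1_support b).
  - by move=> t; exact: derivable_upd.
  - move=> t; rewrite (_ : derive1 _ = partial j f \o upd x j); last first.
      by apply/funext => s; rewrite derive1_upd.
    by apply: continuous_comp; [exact: upd_continuous|exact: cdf].
  - move=> t bt; apply: bf; case: j {df cdf bdf idf} => [[|[|[|//]]] /= ?]; tauto.
case: j => [[|[|[|//]]] lt3] in df cdf bdf idf slice *.
- rewrite (leb3_iterated21 idf); apply: integral0_eq => z _.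
  have iz := integrable_boxed_slice z cdf bdf.
  apply: etrans (esym (@integral21_prod_meas1 _ _ _ _ R leb leb _ iz)) _.
  by apply: integral0_eq => y _; exact: (slice ((0, y), z)).
- rewrite (leb3_iterated21 idf); apply: integral0_eq => z _.
  have iz := integrable_boxed_slice z cdf bdf.
  apply: etrans (esym (@integral12_prod_meas1 _ _ _ _ R leb leb _ iz)) _.
  by apply: integral0_eq => x _; exact: (slice ((x, 0), z)).
- rewrite (leb3_iterated12 idf).
  by apply: integral0_eq => -[x y] _; exact: (slice ((x, y), 0)).
Qed.

End Divergence.

(** * Rules for [C1] functions and symmetry of second derivatives *)

Section Calculus.
Variable R : realType.
Local Notation R3 := (R3 R).
Local Notation coord := (@Defs.coord R).
Implicit Types (x : R3) (f g : R3 -> R) (i j : 'I_3).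

Lemma coord_upd_neq x i j t : i != j -> coord (upd x j t) i = coord x i.
Proof. by case: i => [[|[|[|//]]] ?]; case: j => [[|[|[|//]]] ?]. Qed.

Lemma updC x i j s t : i != j -> upd (upd x i s) j t = upd (upd x j t) i s.
Proof. by case: i => [[|[|[|//]]] ?]; case: j => [[|[|[|//]]] ?]. Qed.

Lemma is_derive_upd f x j (t : R) : C1 f ->
  is_derive t 1 (fun s => f (upd x j s)) (partial j f (upd x j t)).
Proof.
move=> [_ /(_ j)[df _]]; apply: DeriveDef; first exact: derivable_upd.
by rewrite -derive1_upd derive1E.
Qed.

(** Continuous candidates for the partial derivatives give regularity and their values at once, so
    each rule below is proved a single time. *)
Lemma C1P f (df : 'I_3 -> R3 -> R) : continuous f ->
  (forall j, continuous (df j)) ->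
  (forall j x, is_derive (coord x j) 1 (fun t => f (upd x j t)) (df j x)) ->
  C1 f /\ forall j, partial j f = df j.
Proof.
move=> cf cdf fdf; have E j : partial j f = df j.
  by apply/funext => x; rewrite /partial derive1E; have [_ ->] := fdf j x.
split=> //; split=> // j; split; last by rewrite E.
by move=> x; have [] := fdf j x.
Qed.

Lemma is_derive_partial f x j : C1 f ->
  is_derive (coord x j) 1 (fun t => f (upd x j t)) (partial j f x).
Proof. by move=> cf; rewrite -{3}(upd_coord x j); exact: is_derive_upd. Qed.

Lemma C1_continuous f : C1 f -> continuous f. Proof. by case. Qed.

Lemma continuous_partial f j : C1 f -> continuous (partial j f).
Proof. by case=> _ /(_ j)[]. Qed.

Let C1D' f g : C1 f -> C1 g -> C1 (fun x => f x + g x) /\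
  forall j, partial j (fun x => f x + g x) = fun x => partial j f x + partial j g x.
Proof.
move=> cf cg; apply: C1P.
- by move=> x; apply: cvgD; exact: C1_continuous.
- by move=> j x; apply: cvgD; exact: continuous_partial.
- move=> j x.
  exact: (is_deriveD (is_derive_partial x j cf) (is_derive_partial x j cg)).
Qed.

Let C1N' f : C1 f -> C1 (fun x => - f x) /\
  forall j, partial j (fun x => - f x) = fun x => - partial j f x.
Proof.
move=> cf; apply: C1P.
- by move=> x; apply: cvgN; exact: C1_continuous.
- by move=> j x; apply: cvgN; exact: continuous_partial.
- by move=> j x; exact: (is_deriveN (is_derive_partial x j cf)).
Qed.

Let C1M' f g : C1 f -> C1 g -> C1 (fun x => f x * g x) /\
  forall j, partial j (fun x => f x * g x) =
    fun x => f x * partial j g x + g x * partial j f x.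
Proof.
move=> cf cg; apply: C1P.
- by move=> x; apply: cvgM; exact: C1_continuous.
- move=> j x; apply: cvgD; apply: cvgM;
  by [exact: C1_continuous|exact: continuous_partial].
- move=> j x.
  have := is_deriveM (is_derive_partial x j cf) (is_derive_partial x j cg).
  by rewrite !upd_coord.
Qed.

Let C1_coord' i : C1 (coord^~ i) /\
  forall j, partial j (coord^~ i) = fun=> (i == j)%:R.
Proof.
apply: C1P.
- have c1 : continuous (fun x : R3 => x.1) by move=> x; exact: cvg_fst.
  case: i => [[|[|[|//]]] ?] x.
  + exact: (continuous_comp (c1 x) (@cvg_fst _ _ _ _ _)).
  + exact: (continuous_comp (c1 x) (@cvg_snd _ _ _ _ _)).
  + exact: cvg_snd.
- by move=> j x; exact: cvg_cst.
- move=> j x; have [->|ij] := eqVneq i j.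
    under eq_fun do rewrite coord_upd; exact: is_derive_id.
  under eq_fun do rewrite coord_upd_neq //; exact: is_derive_cst.
Qed.

Lemma C1D f g : C1 f -> C1 g -> C1 (fun x => f x + g x).
Proof. by move=> cf cg; have [] := C1D' cf cg. Qed.

Lemma C1N f : C1 f -> C1 (fun x => - f x).
Proof. by move=> cf; have [] := C1N' cf. Qed.

Lemma C1B f g : C1 f -> C1 g -> C1 (fun x => f x - g x).
Proof. by move=> cf cg; apply: C1D => //; exact: C1N. Qed.

Lemma C1M f g : C1 f -> C1 g -> C1 (fun x => f x * g x).
Proof. by move=> cf cg; have [] := C1M' cf cg. Qed.

Lemma C1_coord i : C1 (coord^~ i). Proof. by have [] := C1_coord' i. Qed.

Lemma partialD f g j x : C1 f -> C1 g ->
  partial j (fun x => f x + g x) x = partial j f x + partial j g x.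
Proof. by move=> cf cg; have [_ ->] := C1D' cf cg. Qed.

Lemma partialB f g j x : C1 f -> C1 g ->
  partial j (fun x => f x - g x) x = partial j f x - partial j g x.
Proof.
by move=> cf cg; rewrite partialD //; [have [_ ->] := C1N' cg|exact: C1N].
Qed.

Lemma partialM f g j x : C1 f -> C1 g ->
  partial j (fun x => f x * g x) x = f x * partial j g x + g x * partial j f x.
Proof. by move=> cf cg; have [_ ->] := C1M' cf cg. Qed.

Lemma partial_coord i j x : partial j (coord^~ i) x = (i == j)%:R.
Proof. by have [_ ->] := C1_coord' i. Qed.

Lemma smooth_C1 f : smooth f -> C1 f.
Proof.
move=> sf; split=> [|j]; first by have [] := sf [::].
by split; [move=> x; have [_] := sf [::]; exact|have [] := sf [:: j]].
Qed.

Lemma smooth_partial j f : smooth f -> smooth (partial j f).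
Proof. by move=> sf l; have := sf (rcons l j); rewrite /iter_partial foldr_rcons. Qed.

Section Schwarz.
Local Open Scope classical_set_scope.

Let ball_upd2 x i j (s t u : R) : 0 < u -> `|s - coord x i| < u -> `|t - coord x j| < u ->
  ball x u (upd (upd x i s) j t).
Proof.
move=> u0; rewrite ![`|_ - coord _ _|]distrC.
case: i => [[|[|[|//]]] ?]; case: j => [[|[|[|//]]] ?] => su tu;
  by split; [split|]; rewrite //=; exact: ballxx.
Qed.

(** Two mean value theorems: in direction [i] for the increment [h] taken in direction [j], then in
    direction [j] for the partial derivative [k]. *)
Let mixed_difference f x i j (u : R) : smooth f -> i != j -> 0 < u ->
  let s := coord x i + u in let t := coord x j + u in
  exists2 y, ball x u y &
  f (upd (upd x i s) j t) - f (upd x i s) - f (upd x j t) + f x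
    = u ^+ 2 * partial j (partial i f) y.
Proof.
move=> sf ij u0 s t.
have cf := smooth_C1 sf; have cif := smooth_C1 (smooth_partial i sf).
have ltu (a : R) : a < a + u by rewrite ltrDl.
have ctsf (g dg : R -> R) (a b : R) : (forall r : R, is_derive r 1 g (dg r)) ->
    {within `[a, b], continuous g}.
  move=> dg'; apply: continuous_subspaceT => r.
  by apply: differentiable_continuous; apply/derivable1_diffP; have [] := dg' r.
pose h (r : R) := f (upd (upd x i r) j t) - f (upd x i r).
pose dh (r : R) := partial i f (upd (upd x i r) j t) - partial i f (upd x i r).
have hdh (r : R) : is_derive r 1 h (dh r).
  rewrite /h /dh; under eq_fun do rewrite updC //.
  rewrite updC //.
  exact: (is_deriveB (is_derive_upd (upd x j t) i r cf) (is_derive_upd x i r cf)).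
have [xi xii E1] := MVT (ltu (coord x i)) (fun r _ => hdh r) (ctsf _ _ _ _ hdh).
pose k (r : R) := partial i f (upd (upd x i xi) j r).
pose dk (r : R) := partial j (partial i f) (upd (upd x i xi) j r).
have kdk (r : R) : is_derive r 1 k (dk r) by exact: is_derive_upd.
have [eta etai E2] := MVT (ltu (coord x j)) (fun r _ => kdk r) (ctsf _ _ _ _ kdk).
exists (upd (upd x i xi) j eta).
  move: xii etai; rewrite !in_itv /= => /andP[? ?] /andP[? ?].
  by apply: ball_upd2 => //; rewrite ltr_norml; apply/andP; split; lra.
move: E1; rewrite /h upd_coord -/s.
have -> : dh xi = k (coord x j + u) - k (coord x j).
  by rewrite /dh /k -/t -(coord_upd_neq x xi (_ : j != i)) ?upd_coord // eq_sym.
rewrite E2 /dk => E; transitivity (dk eta * (coord x j + u - coord x j) *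
  (coord x i + u - coord x i)); [rewrite -E; ring|rewrite /dk; ring].
Qed.

(** The second difference is symmetric in [i] and [j], so the two mixed derivatives take equal
    values at points arbitrarily close to [x]; their continuity excludes a gap [d] at [x]. *)
Lemma partialC_smooth f i j x : smooth f ->
  partial i (partial j f) x = partial j (partial i f) x.
Proof.
move=> sf; have [->//|ij] := eqVneq i j.
have tri (p q r e : R) : `|p - r| < e / 2 -> `|q - r| < e / 2 -> `|p - q| < e.
  by move=> pr qr; rewrite [ltRHS]splitr (le_lt_trans (ler_distD r _ _)) // ltrD // distrC.
have cG := C1_continuous (smooth_C1 (smooth_partial i (smooth_partial j sf))).
have cH := C1_continuous (smooth_C1 (smooth_partial j (smooth_partial i sf))).
apply: contrapT => /eqP; rewrite -subr_eq0 -normr_gt0.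
set G := partial i _ in cG *; set H := partial j (partial i f) in cH *.
set d := `|_| => d0; have d2 : 0 < d / 2 by rewrite divr_gt0.
have /cvgrPdist_lt /(_ _ d2) /nbhs_ballP[u /= u0 uG] := cG x.
have /cvgrPdist_lt /(_ _ d2) /nbhs_ballP[v /= v0 vH] := cH x.
pose w := Num.min u v; have w0 : 0 < w by rewrite lt_min u0 v0.
have [y xy Ey] := mixed_difference x sf ij w0.
have ji : j != i by rewrite eq_sym.
have [z xz Ez] := mixed_difference x sf ji w0.
have {Ey Ez} yz : H y = G z.
  have w2 : w ^+ 2 != 0 by rewrite expf_neq0 // gt_eqF.
  by apply: (mulfI w2); rewrite -Ey -Ez (updC x _ _ ij) [X in X + f x = _]addrAC.
have {}xz : `|G x - G z| < d / 2.
  by apply: uG; apply: le_ball xz; rewrite ge_min lexx.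
have {}xy : `|H x - G z| < d / 2.
  by rewrite -yz; apply: vH; apply: le_ball xy; rewrite ge_min lexx orbT.
by have := tri _ _ _ _ xz xy; rewrite ltxx.
Qed.

End Schwarz.

End Calculus.

(** * Radial weights and exact divergences on annular supports *)

Section Annular.
Variable R : realType.
Local Notation R3 := (R3 R).
Local Notation coord := (@Defs.coord R).
Local Notation leb3 := (@leb3 R).
Implicit Types (x : R3) (f g : R3 -> R) (i j : 'I_3).
Local Open Scope classical_set_scope.

Definition sqnrm x : R := coord x 0 * coord x 0 + coord x 1 * coord x 1 + coord x 2 * coord x 2.

Lemma nrmE x : nrm x = Num.sqrt (sqnrm x).
Proof. by rewrite /nrm !expr2. Qed.

Lemma sqnrm_ge0 x : 0 <= sqnrm x.
Proof. by rewrite !addr_ge0 // -expr2 sqr_ge0. Qed.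

Lemma nrm_ge0 x : 0 <= nrm x. Proof. exact: sqrtr_ge0. Qed.

Lemma nrm_sqr x : nrm x ^+ 2 = sqnrm x.
Proof. by rewrite nrmE sqr_sqrtr // sqnrm_ge0. Qed.

Lemma ord3_cases (P : 'I_3 -> Prop) : P 0 -> P 1 -> P 2 -> forall j, P j.
Proof.
move=> P0 P1 P2 [[|[|[|//]]] lt3].
- by rewrite (_ : Ordinal _ = 0) //; exact: val_inj.
- by rewrite (_ : Ordinal _ = 1) //; exact: val_inj.
- by rewrite (_ : Ordinal _ = 2) //; exact: val_inj.
Qed.

Lemma ler_coord_nrm x j : `|coord x j| <= nrm x.
Proof.
rewrite nrmE -sqrtr_sqr ler_sqrt ?sqnrm_ge0 // expr2 /sqnrm.
have := sqr_ge0 (coord x 0); have := sqr_ge0 (coord x 1); have := sqr_ge0 (coord x 2).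
by rewrite !expr2; elim/ord3_cases: j => *; lra.
Qed.

Lemma C1_sqnrm : C1 sqnrm.
Proof. by do ![apply: C1D]; apply: C1M; exact: C1_coord. Qed.

Lemma partial_sqnrm j x : partial j sqnrm x = 2 * coord x j.
Proof.
have cM i := C1M (@C1_coord R i) (@C1_coord R i).
rewrite !(partialD, partialM, partial_coord); [|by do ?[apply: C1D|exact: C1_coord|exact: cM]..].
by elim/ord3_cases: j => /=; ring.
Qed.

Lemma nrm_continuous : continuous (@nrm R).
Proof.
rewrite (_ : @nrm R = Num.sqrt \o sqnrm); last by apply/funext => x; exact: nrmE.
move=> x; apply: continuous_comp; last exact: sqrt_continuous.
exact: (C1_continuous C1_sqnrm).
Qed.

Lemma is_derive_nrm x j : 0 < nrm x ->
  is_derive (coord x j) 1 (fun t => nrm (upd x j t)) (coord x j / nrm x).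
Proof.
move=> x0; have q0 : 0 < sqnrm (upd x j (coord x j)).
  by rewrite upd_coord -sqrtr_gt0 -nrmE.
have := @is_derive1_comp _ Num.sqrt (fun t => sqnrm (upd x j t)) _ _ _
  (is_derive1_sqrt q0) (is_derive_partial x j C1_sqnrm).
rewrite upd_coord -nrmE partial_sqnrm (_ : _ * _ = coord x j / nrm x).
  by under [fun t => nrm _]eq_fun do rewrite nrmE.
by field; rewrite gt_eqF.
Qed.

Definition annulus (a b : R) f := forall x, nrm x < a \/ b < nrm x -> f x = 0.

(** The hole around the origin keeps products with singular radial weights [C1]; the outer bound
    makes them integrable. *)
Definition annular f := exists a b, 0 < a /\ annulus a b f.

Lemma annular_boxed f : annular f -> exists b, boxed b f.
Proof.
move=> [a [b [_ fab]]]; exists b => x bx; apply: fab; right.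
by case: bx => [|[]] h; apply: lt_le_trans h _;
  [exact: (ler_coord_nrm x 0)|exact: (ler_coord_nrm x 1)|exact: (ler_coord_nrm x 2)].
Qed.

Lemma annulus_near a b f x : annulus a b f -> nrm x < a \/ b < nrm x ->
  \forall y \near x, f y = 0.
Proof.
move=> fab [xa|bx].
  by apply: filterS (cvgr_lt _ (@nrm_continuous x) _ xa) => y ya; apply: fab; left.
by apply: filterS (cvgr_gt _ (@nrm_continuous x) _ bx) => y yb; apply: fab; right.
Qed.

Lemma near_upd (P : set R3) x j : (\forall y \near x, P y) ->
  \forall t \near coord x j, P (upd x j t).
Proof. by have := @upd_continuous R x j (coord x j); rewrite /continuous_at upd_coord; apply. Qed.

Lemma annulus_partial a b j f : annulus a b f -> annulus a b (partial j f).
Proof.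
move=> fab x xab; rewrite -(partial_cst j 0 x); apply: partial_near.
exact: near_upd (annulus_near fab xab).
Qed.

Lemma annular_partial j f : annular f -> annular (partial j f).
Proof. by move=> [a [b [a0 fab]]]; exists a, b; split=> //; exact: annulus_partial. Qed.

Lemma annularMl f g : annular f -> annular (fun x => f x * g x).
Proof.
by move=> [a [b [a0 fab]]]; exists a, b; split=> // x /fab ->; rewrite mul0r.
Qed.

Lemma annularMr f g : annular g -> annular (fun x => f x * g x).
Proof.
by move=> [a [b [a0 fab]]]; exists a, b; split=> // x /fab ->; rewrite mulr0.
Qed.

Lemma annularD f g : annular f -> annular g -> annular (fun x => f x + g x).
Proof.
move=> [a [b [a0 fab]]] [c [d [c0 gcd]]]; exists (Num.min a c), (Num.max b d).
split; first by rewrite lt_min a0.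
move=> x; rewrite lt_min gt_max => h; rewrite fab ?gcd ?addr0 //.
  by case: h => /andP[]; auto.
by case: h => /andP[]; auto.
Qed.

Lemma annularN f : annular f -> annular (fun x => - f x).
Proof.
by move=> [a [b [a0 fab]]]; exists a, b; split=> // x /fab ->; rewrite oppr0.
Qed.

Lemma annularB f g : annular f -> annular g -> annular (fun x => f x - g x).
Proof. by move=> af ag; apply: annularD => //; exact: annularN. Qed.

(** Only positive radii are constrained, which admits 1/r and avoids the point where [nrm] has no
    derivative. *)
Definition weight (w dw : R -> R) :=
  (forall r : R, 0 < r -> is_derive r 1 w (dw r)) /\ forall r : R, 0 < r -> {for r, continuous dw}.

Lemma weight_continuous w dw (r : R) : weight w dw -> 0 < r -> {for r, continuous w}.
Proof.
move=> [wd _] /wd[dr _]; apply: differentiable_continuous.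
exact/derivable1_diffP.
Qed.

Lemma annular_continuousM (h f : R3 -> R) : annular f -> continuous f ->
  (forall x, 0 < nrm x -> {for x, continuous h}) ->
  continuous (fun x => h x * f x).
Proof.
move=> [a [b [a0 fab]]] cf ch x; have [xa|ax] := ltP (nrm x) a.
  have nf := annulus_near fab (or_introl xa).
  rewrite /continuous_at fab ?mulr0; last by left.
  by apply: cvg_near_cst; apply: filterS nf => y ->; rewrite mulr0.
by apply: cvgM; [apply: ch; exact: lt_le_trans ax|exact: cf].
Qed.

Lemma C1_weight w dw f : weight w dw -> C1 f -> annular f ->
  C1 (fun x => w (nrm x) * f x) /\ forall j, partial j (fun x => w (nrm x) * f x) =
    fun x => w (nrm x) * partial j f x + dw (nrm x) * (coord x j / nrm x) * f x.
Proof.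
move=> ww cf af.
have cnrm (h : R -> R) x : {for nrm x, continuous h} -> {for x, continuous (h \o @nrm R)}.
  by move=> ch; apply: continuous_comp => //; exact: nrm_continuous.
have cw x : 0 < nrm x -> {for x, continuous (w \o @nrm R)}.
  by move=> /(weight_continuous ww)/cnrm.
apply: C1P.
- apply: annular_continuousM => //; exact: C1_continuous.
- move=> j x; apply: cvgD.
    apply: annular_continuousM => //; first exact: annular_partial.
    exact: continuous_partial.
  apply: annular_continuousM => // [|y y0]; first exact: C1_continuous.
  apply: cvgM; first by apply: cnrm; exact: ww.2.
  apply: cvgM; first exact: (C1_continuous (@C1_coord R j)).
  by apply: cvgV; [rewrite gt_eqF|exact: nrm_continuous].
(* Inside the hole the product is locally zero, and so is the claimed derivative; the chain rule is
   needed only at positive radius. *)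
- move=> j x; move: (af) => [a [b [a0 fab]]]; have [xa|ax] := ltP (nrm x) a.
    rewrite (fab x) ?(annulus_partial j fab) ?mulr0 ?mulr0 ?addr0; [|by left..].
    apply: (@near_eq_is_derive _ _ _ (cst 0)).
    have := near_upd j (annulus_near fab (or_introl xa)).
    by apply: filterS => t ->; rewrite mulr0.
  have x0 : 0 < nrm x by exact: lt_le_trans ax.
  have dw0 : is_derive (nrm (upd x j (coord x j))) 1 w (dw (nrm x)).
    by rewrite upd_coord; exact: ww.1.
  have := is_deriveM (@is_derive1_comp _ w (fun t => nrm (upd x j t)) _ _ _
    dw0 (is_derive_nrm j x0)) (is_derive_partial x j cf).
  move=> [h1 h2]; apply: DeriveDef; first exact: h1.
  apply: etrans h2 _; rewrite /GRing.scale /= !upd_coord; ring.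
Qed.

(** Integrability is part of the notion so that null functions form a vector space and may be added
    under an integral. *)
Definition null f := leb3.-integrable setT (EFin \o f) /\ (\int[leb3]_x (f x)%:E = 0)%E.

Lemma null_ext f g : f =1 g -> null f -> null g.
Proof. by move=> /funext ->. Qed.

Lemma nullD f g : null f -> null g -> null (fun x => f x + g x).
Proof.
move=> [fi f0] [gi g0]; split; first exact: (integrableD measurableT fi gi).
have := integralD measurableT fi gi; rewrite /= f0 g0 addr0 => <-.
by apply: eq_integral.
Qed.

Lemma nullZ (c : R) f : null f -> null (fun x => c * f x).
Proof.
move=> [fi f0]; split; first exact: (integrableZl measurableT c fi).
have := integralZl measurableT fi c; rewrite /= f0 mule0 => <-.
by apply: eq_integral.
Qed.

Lemma nullB f g : null f -> null g -> null (fun x => f x - g x).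
Proof.
move=> nf ng; apply: (null_ext _ (nullD nf (nullZ (-1) ng))) => x.
by rewrite mulN1r.
Qed.

Lemma null_partial j f : C1 f -> annular f -> null (partial j f).
Proof.
move=> cf af; have [b bf] := annular_boxed af; split; last exact: integral_partial bf.
exact: (integrable_boxed (continuous_partial (j := j) cf) (boxed_partial j bf)).
Qed.

Definition rot (a b : 'I_3) f x := coord x a * partial b f x - coord x b * partial a f x.

Definition euler f x := coord x 0 * partial 0 f x + coord x 1 * partial 1 f x
  + coord x 2 * partial 2 f x.

Lemma annular_rot a b f : annular f -> annular (rot a b f).
Proof. by move=> af; apply: annularB; apply: annularMr; exact: annular_partial. Qed.

(** Rotations are divergence free and kill radial functions: the divergence of w f (x_a e_b - x_b
    e_a) retains only the derivative of [f]. *)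
Lemma null_weight_rot w dw a b f : weight w dw -> C1 f -> annular f ->
  null (fun x => w (nrm x) * rot a b f x).
Proof.
move=> ww cf af; have [cg dg] := C1_weight ww cf af.
set g := fun _ => _ in cg dg; have ag : annular g by exact: annularMr.
have cc := @C1_coord R.
have na := null_partial b (C1M (cc a) cg) (annularMr _ ag).
have nb := null_partial a (C1M (cc b) cg) (annularMr _ ag).
apply: null_ext (nullB na nb) => x.
rewrite (partialM b x (cc a) cg) (partialM a x (cc b) cg) !partial_coord !dg /g /rot.
rewrite eq_sym; ring.
Qed.

Lemma weightV : weight (fun r => r^-1) (fun r => - r ^- 2).
Proof.
split=> r r0; last first.
  apply: cvgN; apply: cvgV; first by rewrite expf_neq0 // gt_eqF.
  exact: exprn_continuous.
have r1 : r != 0 by rewrite gt_eqF.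
have := is_deriveV r1 (is_derive_id r 1).
by rewrite /GRing.scale /= mulr1.
Qed.

Lemma weight_expRN : weight (fun r => expR (- r)) (fun r => - expR (- r)).
Proof.
have d (r : R) : is_derive r 1 (fun r => expR (- r)) (- expR (- r)).
  have := is_derive1_comp (is_derive_expR (- r)) (is_deriveN (is_derive_id r 1)).
  by rewrite mulrN1.
split=> r r0; first exact: d.
have [/derivable1_diffP h _] := d r; apply: cvgN.
exact: differentiable_continuous h.
Qed.

(** This is the divergence of x f / r. The coefficient 2 is 3, the divergence of x, minus 1 from
    differentiating 1/r. *)
Lemma null_euler f : C1 f -> annular f ->
  null (fun x => (nrm x)^-1 * (euler f x + 2 * f x)).
Proof.
move=> cf af; have [cg dg] := C1_weight weightV cf af.
set g := fun _ => _ in cg dg; have ag : annular g by exact: annularMr.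
have cc := @C1_coord R.
have n j := null_partial j (C1M (cc j) cg) (annularMr _ ag).
apply: null_ext (nullD (nullD (n 0) (n 1)) (n 2)) => x.
rewrite (partialM 0 x (cc 0) cg) (partialM 1 x (cc 1) cg) (partialM 2 x (cc 2) cg).
rewrite !partial_coord !dg /g /euler !eqxx /=.
have [x0|x0] := eqVneq (nrm x) 0.
  move: af => [a [b [a0 fab]]]; rewrite (fab x); last by left; rewrite x0.
  by rewrite x0 invr0; ring.
have -> : (nrm x)^-1 * (coord x 0 * partial 0 f x + coord x 1 * partial 1 f x +
    coord x 2 * partial 2 f x + 2 * f x) =
  (nrm x)^-1 * (coord x 0 * partial 0 f x + coord x 1 * partial 1 f x +
    coord x 2 * partial 2 f x + 3 * f x) - sqnrm x * ((nrm x)^-1 * nrm x ^- 2) * f x.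
  by rewrite -nrm_sqr; field.
by rewrite /sqnrm; ring.
Qed.

Lemma le_integral_null (A B n : R3 -> R) : leb3.-integrable setT (EFin \o A) ->
  leb3.-integrable setT (EFin \o B) -> null n -> (forall x, A x + n x <= B x) ->
  (\int[leb3]_x (A x)%:E <= \int[leb3]_x (B x)%:E)%E.
Proof.
move=> iA iB [ni n0] AB.
have E : (\int[leb3]_x (A x)%:E = \int[leb3]_x (A x + n x)%:E)%E.
  have := integralD measurableT iA ni; rewrite /= n0 adde0 => <-.
  exact: eq_integral.
rewrite E; apply: le_integral => //; first exact: (integrableD measurableT iA ni).
by move=> x _; rewrite lee_fin.
Qed.

End Annular.

(* Comparing distinct partial derivatives by conversion unfolds them, so they are
   generalized before calling [ring]. *)
Ltac ring_partials :=
  repeat match goal with |- context [rot ?a ?b ?f ?x] =>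
    generalize (rot a b f x); intro end;
  repeat match goal with |- context [euler ?f ?x] =>
    generalize (euler f x); intro end;
  repeat match goal with |- context [partial ?j ?f ?x] =>
    generalize (partial j f x); intro end;
  repeat match goal with |- context [Defs.coord ?x ?j] =>
    generalize (Defs.coord x j); intro end;
  ring.

(** * Commutation of rotations and dilations, and the resulting divergences *)

Section Commutators.
Variable R : realType.
Local Notation R3 := (R3 R).
Local Notation coord := (@Defs.coord R).
Implicit Types (x : R3) (f g : R3 -> R) (a b c p q r : 'I_3).

Lemma C1_rot a b f : smooth f -> C1 (rot a b f).
Proof.
by move=> sf; apply: C1B; apply: C1M; by [exact: C1_coord|exact/smooth_C1/smooth_partial].
Qed.

Lemma C1_euler f : smooth f -> C1 (euler f).
Proof.
move=> sf; do 2?apply: C1D; apply: C1M;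
  by [exact: C1_coord|exact/smooth_C1/smooth_partial].
Qed.

Lemma partial_rot a b c f x : smooth f ->
  partial c (rot a b f) x = coord x a * partial c (partial b f) x
    + (a == c)%:R * partial b f x - coord x b * partial c (partial a f) x
    - (b == c)%:R * partial a f x.
Proof.
move=> sf; have cp j := smooth_C1 (smooth_partial j sf).
have cc := @C1_coord R.
rewrite /rot (partialB c x (C1M (cc a) (cp b)) (C1M (cc b) (cp a))).
rewrite (partialM c x (cc a) (cp b)) (partialM c x (cc b) (cp a)) !partial_coord.
by ring_partials.
Qed.

Lemma delta_sum (h : 'I_3 -> R) c :
  (0 == c)%:R * h 0 + (1 == c)%:R * h 1 + (2 == c)%:R * h 2 = h c.
Proof. by elim/ord3_cases: c; rewrite /= ?eqxx ?mul1r ?mul0r ?addr0 ?add0r. Qed.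

Lemma partial_euler c f x : smooth f ->
  partial c (euler f) x = coord x 0 * partial c (partial 0 f) x
    + coord x 1 * partial c (partial 1 f) x + coord x 2 * partial c (partial 2 f) x
    + partial c f x.
Proof.
move=> sf; have cp j := smooth_C1 (smooth_partial j sf).
have cc := @C1_coord R.
have cm j := C1M (cc j) (cp j).
rewrite /euler (partialD c x (C1D (cm 0) (cm 1)) (cm 2)) (partialD c x (cm 0) (cm 1)).
rewrite (partialM c x (cc 0) (cp 0)) (partialM c x (cc 1) (cp 1)).
rewrite (partialM c x (cc 2) (cp 2)) !partial_coord.
by rewrite -(delta_sum (fun j => partial j f x) c); ring_partials.
Qed.

Lemma rotM a b f g x : C1 f -> C1 g ->
  rot a b (fun y => f y * g y) x = f x * rot a b g x + g x * rot a b f x.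
Proof. by move=> cf cg; rewrite /rot (partialM a x cf cg) (partialM b x cf cg); ring_partials. Qed.

Lemma eulerM f g x : C1 f -> C1 g ->
  euler (fun y => f y * g y) x = f x * euler g x + g x * euler f x.
Proof. by move=> cf cg; rewrite /euler !(partialM _ x cf cg); ring_partials. Qed.

Lemma rot_nrm0 a b f x : nrm x = 0 -> rot a b f x = 0.
Proof.
move=> x0; have c0 k : coord x k = 0.
  by apply/eqP; rewrite -normr_le0 -x0; exact: ler_coord_nrm.
by rewrite /rot !c0 !mul0r subr0.
Qed.

(** The so(3) relation between the generators; second derivatives cancel by symmetry. *)
Lemma rot_commutator p q r f x : smooth f -> p != q -> q != r -> r != p ->
  rot q r (rot r p f) x - rot r p (rot q r f) x = - rot p q f x.
Proof.
move=> sf pq qr rp; rewrite {1}/rot [X in _ - X]/rot !partial_rot // !eqxx.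
rewrite (negbTE rp) (negbTE qr) (negbTE pq) ![_ == p]eq_sym ![_ == q]eq_sym.
rewrite ?(negbTE rp) ?(negbTE qr) ?(negbTE pq) ?[r == q]eq_sym ?(negbTE qr).
rewrite ?[p == r]eq_sym ?(negbTE rp) ?[q == p]eq_sym ?(negbTE pq).
rewrite (partialC_smooth q p x sf) (partialC_smooth r p x sf) (partialC_smooth r q x sf) /rot /=.
by ring_partials.
Qed.

(** Dilations commute with rotations. *)
Lemma euler_rotC a b f x : smooth f -> euler (rot a b f) x = rot a b (euler f) x.
Proof.
move=> sf; rewrite {1}/euler [in RHS]/rot !partial_rot // !partial_euler //.
rewrite !(partialC_smooth a 0 x sf) !(partialC_smooth a 1 x sf) !(partialC_smooth a 2 x sf).
rewrite !(partialC_smooth b 0 x sf) !(partialC_smooth b 1 x sf) !(partialC_smooth b 2 x sf).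
rewrite -(delta_sum (Defs.coord x) a) -(delta_sum (Defs.coord x) b) ![_ == 0]eq_sym.
rewrite ![_ == 1]eq_sym ![_ == 2]eq_sym; ring_partials.
Qed.

(** The first two terms are a cross term of |sigma.L chi|^2. Moving one rotation over to [g]
    produces the commutator, hence the third, first-order term, up to a divergence. *)
Definition rot2 p q r f g x :=
  rot q r f x * rot r p g x - rot r p f x * rot q r g x - f x * rot p q g x.

Lemma null_rot2 w dw p q r f g : weight w dw -> smooth f -> smooth g ->
  annular f -> p != q -> q != r -> r != p ->
  null (fun x => w (nrm x) * rot2 p q r f g x).
Proof.
move=> ww sf sg af pq qr rp; have cf := smooth_C1 sf.
have cr a b := C1_rot a b sg.
have n1 := null_weight_rot q r ww (C1M cf (cr r p)) (annularMl _ af).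
have n2 := null_weight_rot r p ww (C1M cf (cr q r)) (annularMl _ af).
apply: null_ext (nullB n1 n2) => x.
rewrite (rotM q r x cf (cr r p)) (rotM r p x cf (cr q r)) /rot2.
have E : rot p q g x = rot r p (rot q r g) x - rot q r (rot r p g) x.
  by rewrite -[LHS]opprK -(rot_commutator x sg pq qr rp) opprB.
by rewrite E; ring_partials.
Qed.

(** The polarized form of: a product of two commuting skew operators, (R + 1) / r and a rotation, is
    symmetric. This is where K commuting with (R + 1) / r is used. *)
Lemma null_euler_rot a b f g : smooth f -> smooth g -> annular f ->
  null (fun x => (nrm x)^-1 *
    ((euler f x + f x) * rot a b g x - (euler g x + g x) * rot a b f x)).
Proof.
move=> sf sg af; have cf := smooth_C1 sf; have cg := smooth_C1 sg.
have n1 := null_euler (C1M cf (C1_rot a b sg)) (annularMl _ af).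
have n2 := null_weight_rot a b (@weightV R) (C1M cf (C1_euler sg)) (annularMl _ af).
have n3 := null_weight_rot a b (@weightV R) (C1M cf cg) (annularMl _ af).
apply: null_ext (nullB (nullB n1 n2) n3) => x.
rewrite (eulerM x cf (C1_rot a b sg)) (rotM a b x cf (C1_euler sg)) (rotM a b x cf cg).
by rewrite (euler_rotC a b x sg); ring_partials.
Qed.

(** Skewness of (R + 1) / r on the diagonal: half of [null_euler] at f^2. *)
Lemma null_euler_sqr f : smooth f -> annular f ->
  null (fun x => (nrm x)^-1 * ((euler f x + f x) * f x)).
Proof.
move=> sf af; have cf := smooth_C1 sf.
have n1 := nullZ (2^-1) (null_euler (C1M cf cf) (annularMl _ af)).
apply: null_ext n1 => x; rewrite (eulerM x cf cf); move: (euler f x) (nrm x) => e r.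
by move: r^-1 => s; field.
Qed.

End Commutators.

(** * Pointwise algebraic inequalities *)

Section TangentialBound.
Variable R : realFieldType.

(* The Pauli matrices occur below through the real components (a, b, c, d) of a
   two-spinor (a + ib, c + id).  The squares [t] are those of
   2 (|x|^2 M_k - (|x|^2 sigma_k - x_k sigma.x) (sigma.M) / 2), with [y] the
   components of (sigma.x) (sigma.M). *)
Lemma sqr_pauli_tangential (x1 x2 x3 : R)
    (p1 p2 p3 q1 q2 q3 u1 u2 u3 v1 v2 v3 : R) :
  x1 * p1 + x2 * p2 + x3 * p3 = 0 -> x1 * q1 + x2 * q2 + x3 * q3 = 0 ->
  x1 * u1 + x2 * u2 + x3 * u3 = 0 -> x1 * v1 + x2 * v2 + x3 * v3 = 0 ->
  0 < x1 ^+ 2 + x2 ^+ 2 + x3 ^+ 2 ->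
  (p3 + u1 + v2) ^+ 2 + (q3 + v1 - u2) ^+ 2 + (p1 - q2 - u3) ^+ 2 + (q1 + p2 - v3) ^+ 2
  <= 2 * (p1 ^+ 2 + p2 ^+ 2 + p3 ^+ 2 + (q1 ^+ 2 + q2 ^+ 2 + q3 ^+ 2)
          + (u1 ^+ 2 + u2 ^+ 2 + u3 ^+ 2) + (v1 ^+ 2 + v2 ^+ 2 + v3 ^+ 2)).
Proof.
move=> hp hq hu hv; set s := x1 ^+ 2 + _ + _ => s0.
set n1 := p3 + u1 + v2; set n2 := q3 + v1 - u2.
set n3 := p1 - q2 - u3; set n4 := q1 + p2 - v3; set m := _ + _ + (v1 ^+ 2 + _ + _).
pose y1 := x3 * n1 + x1 * n3 + x2 * n4; pose y2 := x3 * n2 + x1 * n4 - x2 * n3.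
pose y3 := x1 * n1 - x2 * n2 - x3 * n3; pose y4 := x1 * n2 + x2 * n1 - x3 * n4.
pose t m n x y : R := (2 * s * m - s * n + x * y) ^+ 2.
have t0 m' n x y : 0 <= t m' n x y by exact: sqr_ge0.
(* With N = sigma.M given and M tangential, the least |M|^2 is |N|^2 / 2, attained at M_k = (sigma_k
   - x_k (sigma.x) / s) N / 2. The squares measure the distance to this minimizer; the tangency
   relations enter with multipliers. *)
have E : 2 * s ^+ 2 * (2 * m - (n1 ^+ 2 + n2 ^+ 2 + n3 ^+ 2 + n4 ^+ 2)) =
   (t p1 n3 x1 y1 + t q1 n4 x1 y2 + t u1 n1 x1 y3 + t v1 n2 x1 y4)
   + (t p2 n4 x2 y1 + t q2 (- n3) x2 y2 + t u2 (- n2) x2 y3 + t v2 n1 x2 y4)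
   + (t p3 n1 x3 y1 + t q3 n2 x3 y2 + t u3 (- n3) x3 y3 + t v3 (- n4) x3 y4)
   - 4 * s * ((x1 * p1 + x2 * p2 + x3 * p3) * y1 + (x1 * q1 + x2 * q2 + x3 * q3) * y2
     + (x1 * u1 + x2 * u2 + x3 * u3) * y3 + (x1 * v1 + x2 * v2 + x3 * v3) * y4).
  by rewrite /t /y1 /y2 /y3 /y4 /n1 /n2 /n3 /n4 /m /s; ring.
rewrite -subr_ge0 -(pmulr_rge0 _ (_ : 0 < 2 * s ^+ 2)) ?mulr_gt0 ?exprn_gt0 //.
by rewrite E hp hq hu hv !mul0r !addr0 mulr0 subr0 !addr_ge0.
Qed.

End TangentialBound.

(** The convexity bound e^{r-1} >= 1 + (r - 1), whose tangency point r = 1 is where e^r / r attains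
    its minimum e. *)
Lemma expR1_ler (R : realType) (r : R) : 0 < r -> expR 1 * expR (- r) <= r^-1.
Proof.
move=> r0; rewrite -expRD -[leLHS]invrK lef_pV2 ?posrE ?invr_gt0 ?expR_gt0 //.
by rewrite -expRN; apply: le_trans (expR_ge1Dx _); lra.
Qed.

(** Used with [eps], [eta], [rho] equal to e^{-r}, e^r, 1/r, and with [g], [k] components of (R + 1)
    chi and K chi. Completing the square leaves the remainder 2 e k^2 (rho - e eps). *)
Lemma sqr_radial_bound (R : realFieldType) (e eps eta rho g k : R) :
  0 <= e -> 0 <= eta -> eps * eta = 1 -> e * eps <= rho ->
  e ^+ 2 * (eps * k ^+ 2) - 2 * e * (rho * (g * k)) <= eta * (rho * (g - k)) ^+ 2.
Proof.
move=> e0 eta0 ee er; rewrite -subr_ge0.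
(* The last summand, a multiple of 1 - eps eta = 0, turns this into a polynomial identity. *)
rewrite (_ : _ - _ = eta * (rho * (g - k) + e * eps * k) ^+ 2
    + 2 * e * (k ^+ 2 * (rho - e * eps))
    + (e ^+ 2 * eps * k ^+ 2 + 2 * e * rho * k * (g - k)) * (1 - eps * eta)); last by ring.
rewrite ee subrr mulr0 addr0 addr_ge0 //; first by rewrite mulr_ge0 ?sqr_ge0.
have h1 : 0 <= 2 * e by rewrite mulr_ge0.
have h2 : 0 <= rho - e * eps by rewrite subr_ge0.
exact: mulr_ge0 h1 (mulr_ge0 (sqr_ge0 k) h2).
Qed.

(** * The two estimates for a single two-spinor *)

Section TwoSpinors.
Variable R : realType.
Local Notation R3 := (R3 R).
Local Notation coord := (@Defs.coord R).
Implicit Types (f g : R3 -> R) (x : R3).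
Variables a b c d : R3 -> R.
Hypotheses (sa : smooth a) (sb : smooth b) (sc : smooth c) (sd : smooth d).
Hypotheses (aa : annular a) (ab : annular b) (ac : annular c) (ad : annular d).

(* Real components of (sigma.L) chi and (sigma.nabla) chi for chi = (a + ib, c + id);
   [rot 1 2], [rot 2 0] and [rot 0 1] are the components of x /\ nabla. *)
Definition so1 x := rot 0 1 b x + rot 1 2 d x - rot 2 0 c x.
Definition so2 x := - (rot 0 1 a x + rot 1 2 c x + rot 2 0 d x).
Definition so3 x := rot 1 2 b x + rot 2 0 a x - rot 0 1 d x.
Definition so4 x := - (rot 1 2 a x - rot 2 0 b x - rot 0 1 c x).

Definition weyl1 x := partial 2 a x + partial 0 c x + partial 1 d x.
Definition weyl2 x := partial 2 b x + partial 0 d x - partial 1 c x.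
Definition weyl3 x := partial 0 a x - partial 1 b x - partial 2 c x.
Definition weyl4 x := partial 0 b x + partial 1 a x - partial 2 d x.

Definition sqr_spinor x := a x ^+ 2 + b x ^+ 2 + c x ^+ 2 + d x ^+ 2.
Definition sqr_so x := (a x + so1 x) ^+ 2 + (b x + so2 x) ^+ 2
  + (c x + so3 x) ^+ 2 + (d x + so4 x) ^+ 2.
Definition sqr_weyl x := weyl1 x ^+ 2 + weyl2 x ^+ 2 + weyl3 x ^+ 2 + weyl4 x ^+ 2.

Let rot_tangential f x :
  coord x 0 * rot 1 2 f x + coord x 1 * rot 2 0 f x + coord x 2 * rot 0 1 f x = 0.
Proof. by rewrite /rot; ring_partials. Qed.

Let sqr_rot_bound x :
  so1 x ^+ 2 + so2 x ^+ 2 + so3 x ^+ 2 + so4 x ^+ 2 <=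
  2 * (rot 1 2 a x ^+ 2 + rot 2 0 a x ^+ 2 + rot 0 1 a x ^+ 2
       + (rot 1 2 b x ^+ 2 + rot 2 0 b x ^+ 2 + rot 0 1 b x ^+ 2)
       + (rot 1 2 c x ^+ 2 + rot 2 0 c x ^+ 2 + rot 0 1 c x ^+ 2)
       + (rot 1 2 d x ^+ 2 + rot 2 0 d x ^+ 2 + rot 0 1 d x ^+ 2)).
Proof.
have [x0|x0] := eqVneq (nrm x) 0.
  rewrite /so1 /so2 /so3 /so4 !(rot_nrm0 _ _ _ x0); lra.
have s0 : 0 < coord x 0 ^+ 2 + coord x 1 ^+ 2 + coord x 2 ^+ 2.
  by have : 0 < nrm x ^+ 2; [rewrite exprn_gt0 // lt_neqAle eq_sym x0 nrm_ge0|
    rewrite nrm_sqr /sqnrm -!expr2].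
have := sqr_pauli_tangential (rot_tangential a x) (rot_tangential b x)
  (rot_tangential c x) (rot_tangential d x) s0.
apply: le_trans; rewrite /so1 /so2 /so3 /so4 !sqrrN.
by rewrite le_eqVlt; apply/orP; left; apply/eqP; ring_partials.
Qed.

(* (sigma.L)^2 = L^2 - sigma.L holds up to an exact divergence. *)
Lemma le_pauli_spin_orbit : exists2 n, null n & forall x,
  expR (- nrm x) * sqr_spinor x + n x <= expR (- nrm x) * sqr_so x.
Proof.
have cC f g : smooth f -> smooth g -> C1 (fun x => f x * g x).
  by move=> sf sg; apply: C1M; exact: smooth_C1.
have w := @weight_expRN R.
have M i j f g (sf : smooth f) (sg : smooth g) (af : annular f) :=
  null_weight_rot i j w (cC f g sf sg) (annularMl g af).
have N12 f g (sf : smooth f) (sg : smooth g) (af : annular f) :=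
  @null_rot2 _ _ _ 0 1 2 f g w sf sg af isT isT isT.
have N23 f g (sf : smooth f) (sg : smooth g) (af : annular f) :=
  @null_rot2 _ _ _ 1 2 0 f g w sf sg af isT isT isT.
have N31 f g (sf : smooth f) (sg : smooth g) (af : annular f) :=
  @null_rot2 _ _ _ 2 0 1 f g w sf sg af isT isT isT.
have nN := nullB (nullD (nullD (nullD (nullB (N12 c d sc sd ac) (N12 a b sa sb aa))
  (N31 b d sb sd ab)) (N31 a c sa sc aa)) (N23 b c sb sc ab)) (N23 a d sa sd aa).
have nM := nullB (nullB (nullB (nullB (nullD (M 0 1 a b sa sb aa) (M 1 2 a d sa sd aa))
  (M 2 0 a c sa sc aa)) (M 1 2 b c sb sc ab)) (M 2 0 b d sb sd ab)) (M 0 1 c d sc sd ac).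
(* [n] is e^{-r} times 2 <chi, sigma.L chi> + 2 |sigma.L chi|^2 - 2 |L chi|^2. Squaring doubles the
   cross terms, hence 4 [nN]; for each of the six pairs of components this leaves, up to sign, 4 f
   rot g, which -2 [nM] antisymmetrizes to 2 (f rot g - g rot f). What remains is 2 |L chi|^2 -
   |sigma.L chi|^2. *)
have n := nullD (nullZ 4 nN) (nullZ (-2) nM).
apply: (ex_intro2 _ _ _ n) => x /=; have bx := sqr_rot_bound x.
rewrite !(rotM _ _ x (smooth_C1 _) (smooth_C1 _)) //.
have := expR_gt0 (- nrm x); move: (expR _) => e e0.
rewrite -subr_ge0; move: bx; rewrite -subr_ge0 => /(mulr_ge0 (ltW e0)).
move=> /le_trans; apply; rewrite le_eqVlt; apply/orP; left; apply/eqP.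
by rewrite /sqr_so /sqr_spinor /so1 /so2 /so3 /so4 /rot2; ring_partials.
Qed.

(** At positive radius (sigma.x) / r is unitary, so applying it to (sigma.nabla) chi preserves the
    norm. *)
Let sqr_weyl_polar x : nrm x ^+ 2 * sqr_weyl x = (euler a x - so1 x) ^+ 2
  + (euler b x - so2 x) ^+ 2 + (euler c x - so3 x) ^+ 2 + (euler d x - so4 x) ^+ 2.
Proof.
rewrite nrm_sqr /sqr_weyl /so1 /so2 /so3 /so4 /weyl1 /weyl2 /weyl3 /weyl4.
by rewrite /euler /rot /sqnrm; ring_partials.
Qed.

Let annular0 f x : annular f -> nrm x = 0 -> f x = 0.
Proof. by move=> [p [q [p0 fpq]]] x0; apply: fpq; left; rewrite x0. Qed.

(* (sigma.x)(sigma.nabla) = x.nabla - sigma.L, and (x.nabla + 1) / r is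
   skew-adjoint and commutes with 1 + sigma.L. *)
Lemma le_spin_orbit_weyl : exists2 n, null n & forall x,
  expR 1 ^+ 2 * (expR (- nrm x) * sqr_so x) + n x <= expR (nrm x) * sqr_weyl x.
Proof.
have nE := nullD (nullD (nullD (null_euler_sqr sa aa) (null_euler_sqr sb ab))
  (null_euler_sqr sc ac)) (null_euler_sqr sd ad).
have N i j f g (sf : smooth f) (sg : smooth g) (af : annular f) :=
  null_euler_rot i j sf sg af.
have nR := nullB (nullB (nullB (nullB (nullD (N 0 1 a b sa sb aa) (N 1 2 a d sa sd aa))
  (N 2 0 a c sa sc aa)) (N 1 2 b c sb sc ab)) (N 2 0 b d sb sd ab)) (N 0 1 c d sc sd ac).
(* The cross term of [sqr_radial_bound]: [nE] and [nR] are the contributions to <(R + 1) chi, K chi>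
   / r of 1 and of sigma.L in K. *)
have n := nullZ (- 2 * expR 1) (nullD nE nR).
apply: (ex_intro2 _ _ _ n) => x /=.
have [x0|x0] := eqVneq (nrm x) 0.
  rewrite /sqr_so /so1 /so2 /so3 /so4 !(rot_nrm0 _ _ _ x0) x0 invr0.
  rewrite (annular0 aa x0) (annular0 ab x0) (annular0 ac x0) (annular0 ad x0).
  rewrite (_ : _ + _ = 0); last by ring_partials.
  by rewrite mulr_ge0 ?expR_ge0 // !addr_ge0 ?sqr_ge0.
have r0 : 0 < nrm x by rewrite lt_neqAle eq_sym x0 nrm_ge0.
have -> : sqr_weyl x = (nrm x)^-1 ^+ 2 * (nrm x ^+ 2 * sqr_weyl x).
  by rewrite mulrA -exprMn mulVf // expr1n mul1r.
have ee : expR (- nrm x) * expR (nrm x) = 1 by rewrite -expRD addNr expR0.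
have := sqr_radial_bound _ _ (expR_ge0 1) (expR_ge0 (nrm x)) ee (expR1_ler r0) => B.
have B1 := B (euler a x + a x) (a x + so1 x).
have B2 := B (euler b x + b x) (b x + so2 x).
have B3 := B (euler c x + c x) (c x + so3 x).
have B4 := B (euler d x + d x) (d x + so4 x).
rewrite sqr_weyl_polar -subr_ge0.
have {B1 B2 B3 B4} := lerD (lerD (lerD B1 B2) B3) B4; rewrite -subr_ge0.
move=> /le_trans; apply; rewrite le_eqVlt; apply/orP; left; apply/eqP.
rewrite /sqr_so /so1 /so2 /so3 /so4.
move: (nrm x)^-1 (expR (- nrm x)) (expR (nrm x)) (expR 1) => p q u v.
by ring_partials.
Qed.

End TwoSpinors.

(** * From four-spinors to real components of two-spinors *)

Section Components.
Variable R : realType.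
Local Notation R3 := (R3 R).
Local Open Scope complex_scope.
Implicit Types (psi : spinor R) (x : R3) (v : 'cV[R[i]]_4).

(** Indices are written as shifts so that they match the blocks of [block_mx]. *)
Definition up0 : 'I_4 := lshift 2 (0 : 'I_2).
Definition up1 : 'I_4 := lshift 2 (1 : 'I_2).
Definition dn0 : 'I_4 := rshift 2 (0 : 'I_2).
Definition dn1 : 'I_4 := rshift 2 (1 : 'I_2).

Definition re_part psi k x := complex.Re (psi x k 0).
Definition im_part psi k x := complex.Im (psi x k 0).

Definition normsqC (z : R[i]) : R := complex.Re z ^+ 2 + complex.Im z ^+ 2.

Lemma norm2E v : norm2 v =
  normsqC (v up0 0) + normsqC (v up1 0) + (normsqC (v dn0 0) + normsqC (v dn1 0)).
Proof.
rewrite /norm2 [LHS](@big_split_ord _ _ _ 2 2) /= !big_ord_recl !big_ord0 !addr0.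
by rewrite /normsqC; do ![congr (_ + _)]; congr (complex.Re (v _ 0) ^+ 2) || congr (complex.Im (v _ 0) ^+ 2); exact: val_inj.
Qed.

Lemma sum_ord3 (V : zmodType) (F : 'I_3 -> V) : \sum_(j < 3) F j = F 0 + F 1 + F 2.
Proof.
rewrite !big_ord_recl big_ord0 addr0 addrA.
by congr (_ + F _ + F _); exact: val_inj.
Qed.

Lemma sigma_mulE j (u : 'cV[R[i]]_2) a : (sigma R j *m u) a 0 =
  sigma R j a 0 * u 0 0 + sigma R j a 1 * u 1 0.
Proof.
rewrite mxE !big_ord_recl big_ord0 addr0.
by congr (_ * _ + sigma R j a _ * u _ 0); exact: val_inj.
Qed.

Lemma block_mul_up (A B C D : 'M[R[i]]_2) v (a : 'I_2) :
  ((block_mx A B C D : 'M[R[i]]_4) *m v) (lshift 2 a) 0 =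
  (A *m usubmx (v : 'cV[R[i]]_(2 + 2)) + B *m dsubmx (v : 'cV[R[i]]_(2 + 2))) a 0.
Proof.
transitivity ((block_mx A B C D *m col_mx (usubmx (v : 'cV[R[i]]_(2 + 2)))
  (dsubmx (v : 'cV[R[i]]_(2 + 2)))) (lshift 2 a) 0); first by rewrite vsubmxK.
by rewrite mul_block_col col_mxEu.
Qed.

Lemma block_mul_dn (A B C D : 'M[R[i]]_2) v (a : 'I_2) :
  ((block_mx A B C D : 'M[R[i]]_4) *m v) (rshift 2 a) 0 =
  (C *m usubmx (v : 'cV[R[i]]_(2 + 2)) + D *m dsubmx (v : 'cV[R[i]]_(2 + 2))) a 0.
Proof.
transitivity ((block_mx A B C D *m col_mx (usubmx (v : 'cV[R[i]]_(2 + 2)))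
  (dsubmx (v : 'cV[R[i]]_(2 + 2)))) (rshift 2 a) 0); first by rewrite vsubmxK.
by rewrite mul_block_col col_mxEd.
Qed.

Lemma alpha_mul_up j v (a : 'I_2) : (alpha R j *m v) (lshift 2 a) 0 =
  sigma R j a 0 * v dn0 0 + sigma R j a 1 * v dn1 0.
Proof.
by rewrite block_mul_up mul0mx add0r sigma_mulE [dsubmx _ 0 0]mxE [dsubmx _ 1 0]mxE.
Qed.

Lemma alpha_mul_dn j v (a : 'I_2) : (alpha R j *m v) (rshift 2 a) 0 =
  sigma R j a 0 * v up0 0 + sigma R j a 1 * v up1 0.
Proof.
by rewrite block_mul_dn mul0mx addr0 sigma_mulE [usubmx _ 0 0]mxE [usubmx _ 1 0]mxE.
Qed.

Lemma spin_mul_up j v (a : 'I_2) : 2%:R * (spin R j *m v) (lshift 2 a) 0 =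
  sigma R j a 0 * v up0 0 + sigma R j a 1 * v up1 0.
Proof.
rewrite /spin -scalemxAl mxE mulrA divff ?pnatr_eq0 // mul1r.
by rewrite block_mul_up mul0mx addr0 sigma_mulE [usubmx _ 0 0]mxE [usubmx _ 1 0]mxE.
Qed.

Lemma spin_mul_dn j v (a : 'I_2) : 2%:R * (spin R j *m v) (rshift 2 a) 0 =
  sigma R j a 0 * v dn0 0 + sigma R j a 1 * v dn1 0.
Proof.
rewrite /spin -scalemxAl mxE mulrA divff ?pnatr_eq0 // mul1r.
by rewrite block_mul_dn mul0mx add0r sigma_mulE [dsubmx _ 0 0]mxE [dsubmx _ 1 0]mxE.
Qed.

Lemma partialSE j psi x k : partialS j psi x k 0 =
  (partial j (re_part psi k) x) +i* (partial j (im_part psi k) x).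
Proof. by rewrite mxE. Qed.

Lemma angmomE k psi x l : angmom k psi x l 0 =
  (rot (k + 1) (k + 2) (im_part psi l) x) +i* (- rot (k + 1) (k + 2) (re_part psi l) x).
Proof.
rewrite /angmom mxE [X in _ * X]mxE [X in _ * (X + _)]mxE [X in _ * (_ + X)]mxE.
rewrite [X in _ * (_ - X)]mxE !partialSE /rot.
move: (partial _ _ _) (partial _ _ _) (partial _ _ _) (partial _ _ _) => p q r s.
by simpc; congr Complex; ring.
Qed.

Lemma normsqC_i (z : R[i]) : normsqC (- 'i * z) = normsqC z.
Proof. by case: z => p q; rewrite /normsqC; simpc => /=; ring. Qed.

Lemma normsqC_D (z : R[i]) (u v : R) :
  normsqC (z + (u +i* v)) = (complex.Re z + u) ^+ 2 + (complex.Im z + v) ^+ 2.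
Proof. by case: z. Qed.

Lemma sigma_sum0 (p1 p2 q1 q2 : 'I_3 -> R) :
  \sum_j (sigma R j 0 0 * (p1 j +i* p2 j) + sigma R j 0 1 * (q1 j +i* q2 j)) =
  (p1 2 + q1 0 + q2 1) +i* (p2 2 + q2 0 - q1 1).
Proof. by rewrite sum_ord3 /sigma !mxE /=; simpc; congr Complex; ring. Qed.

Lemma sigma_sum1 (p1 p2 q1 q2 : 'I_3 -> R) :
  \sum_j (sigma R j 1 0 * (p1 j +i* p2 j) + sigma R j 1 1 * (q1 j +i* q2 j)) =
  (p1 0 - p2 1 - q1 2) +i* (p2 0 + p1 1 - q2 2).
Proof. by rewrite sum_ord3 /sigma !mxE /=; simpc; congr Complex; ring. Qed.

Lemma dirac_up (a : 'I_2) psi x : Defs.dirac psi x (lshift 2 a : 'I_4) 0 = - 'i *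
  \sum_j (sigma R j a 0 * (partial j (re_part psi dn0) x +i* partial j (im_part psi dn0) x)
    + sigma R j a 1 * (partial j (re_part psi dn1) x +i* partial j (im_part psi dn1) x)).
Proof.
rewrite /Defs.dirac mxE summxE; congr (_ * _); apply: eq_bigr => j _.
by rewrite alpha_mul_up (partialSE j psi x dn0) (partialSE j psi x dn1).
Qed.

Lemma dirac_dn (a : 'I_2) psi x : Defs.dirac psi x (rshift 2 a : 'I_4) 0 = - 'i *
  \sum_j (sigma R j a 0 * (partial j (re_part psi up0) x +i* partial j (im_part psi up0) x)
    + sigma R j a 1 * (partial j (re_part psi up1) x +i* partial j (im_part psi up1) x)).
Proof.
rewrite /Defs.dirac mxE summxE; congr (_ * _); apply: eq_bigr => j _.
by rewrite alpha_mul_dn (partialSE j psi x up0) (partialSE j psi x up1).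
Qed.

(** The off-diagonal blocks of [alpha] exchange the upper and lower two-spinors, and the factor -i
    does not affect the modulus. *)
Lemma norm2_dirac psi x : norm2 (Defs.dirac psi x) =
  sqr_weyl (re_part psi dn0) (im_part psi dn0) (re_part psi dn1) (im_part psi dn1) x +
  sqr_weyl (re_part psi up0) (im_part psi up0) (re_part psi up1) (im_part psi up1) x.
Proof.
rewrite norm2E (dirac_up 0 psi x) (dirac_up 1 psi x) (dirac_dn 0 psi x) (dirac_dn 1 psi x).
rewrite !normsqC_i.
rewrite 2!sigma_sum0 2!sigma_sum1 /normsqC /= /sqr_weyl /weyl1 /weyl2 /weyl3 /weyl4.
by ring_partials.
Qed.

Let rotk (k : 'I_3) (f : R3 -> R) x := rot (k + 1) (k + 2) f x.

Lemma spin_orbit_up (a : 'I_2) psi x : spin_orbit_op psi x (lshift 2 a : 'I_4) 0 =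
  psi x (lshift 2 a : 'I_4) 0 +
  \sum_j (sigma R j a 0 * (rotk j (im_part psi up0) x +i* (- rotk j (re_part psi up0) x))
    + sigma R j a 1 * (rotk j (im_part psi up1) x +i* (- rotk j (re_part psi up1) x))).
Proof.
rewrite /spin_orbit_op mxE [X in _ + X]mxE summxE mulr_sumr; congr (_ + _).
apply: eq_bigr => j _.
by rewrite spin_mul_up (angmomE j psi x up0) (angmomE j psi x up1).
Qed.

Lemma spin_orbit_dn (a : 'I_2) psi x : spin_orbit_op psi x (rshift 2 a : 'I_4) 0 =
  psi x (rshift 2 a : 'I_4) 0 +
  \sum_j (sigma R j a 0 * (rotk j (im_part psi dn0) x +i* (- rotk j (re_part psi dn0) x))
    + sigma R j a 1 * (rotk j (im_part psi dn1) x +i* (- rotk j (re_part psi dn1) x))).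
Proof.
rewrite /spin_orbit_op mxE [X in _ + X]mxE summxE mulr_sumr; congr (_ + _).
apply: eq_bigr => j _.
by rewrite spin_mul_dn (angmomE j psi x dn0) (angmomE j psi x dn1).
Qed.

Lemma norm2_spin_orbit psi x : norm2 (spin_orbit_op psi x) =
  sqr_so (re_part psi up0) (im_part psi up0) (re_part psi up1) (im_part psi up1) x +
  sqr_so (re_part psi dn0) (im_part psi dn0) (re_part psi dn1) (im_part psi dn1) x.
Proof.
rewrite norm2E (spin_orbit_up 0 psi x) (spin_orbit_up 1 psi x).
rewrite (spin_orbit_dn 0 psi x) (spin_orbit_dn 1 psi x).
rewrite 2!sigma_sum0 2!sigma_sum1.
have r0 f : rotk 0 f x = rot 1 2 f x by congr (rot _ _ f x); exact: val_inj.
have r1 f : rotk 1 f x = rot 2 0 f x by congr (rot _ _ f x); exact: val_inj.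
have r2 f : rotk 2 f x = rot 0 1 f x by congr (rot _ _ f x); exact: val_inj.
rewrite 4!normsqC_D !r0 !r1 !r2 /sqr_so /so1 /so2 /so3 /so4.
rewrite -/(re_part psi up0 x) -/(re_part psi up1 x) -/(re_part psi dn0 x).
rewrite -/(re_part psi dn1 x) -/(im_part psi up0 x) -/(im_part psi up1 x).
rewrite -/(im_part psi dn0 x) -/(im_part psi dn1 x).
move: (re_part psi up0 x) (re_part psi up1 x) (re_part psi dn0 x) (re_part psi dn1 x).
move: (im_part psi up0 x) (im_part psi up1 x) (im_part psi dn0 x) (im_part psi dn1 x).
by move=> *; ring_partials.
Qed.

Lemma norm2_pauli psi x : norm2 (psi x) =
  sqr_spinor (re_part psi up0) (im_part psi up0) (re_part psi up1) (im_part psi up1) x +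
  sqr_spinor (re_part psi dn0) (im_part psi dn0) (re_part psi dn1) (im_part psi dn1) x.
Proof. by rewrite norm2E /sqr_spinor /normsqC /re_part /im_part; ring. Qed.

End Components.

(** * The two inequalities for test spinors *)

Section TestSpinors.
Variable R : realType.
Local Notation R3 := (R3 R).
Local Notation leb3 := (@leb3 R).
Implicit Types (f g : R3 -> R) (x : R3) (psi : spinor R).

Definition cannular f := continuous f /\ annular f.

Lemma cannularD f g : cannular f -> cannular g -> cannular (fun x => f x + g x).
Proof.
by move=> [cf af] [cg ag]; split; [move=> x; apply: cvgD; [exact: cf|exact: cg]|exact: annularD].
Qed.

Lemma cannularB f g : cannular f -> cannular g -> cannular (fun x => f x - g x).
Proof.
by move=> [cf af] [cg ag]; split; [move=> x; apply: cvgB; [exact: cf|exact: cg]|exact: annularB].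
Qed.

Lemma cannularN f : cannular f -> cannular (fun x => - f x).
Proof.
by move=> [cf af]; split; [move=> x; apply: cvgN; exact: cf|exact: annularN].
Qed.

Lemma cannularM f g : continuous f -> cannular g -> cannular (fun x => f x * g x).
Proof.
by move=> cf [cg ag]; split; [move=> x; apply: cvgM; [exact: cf|exact: cg]|exact: annularMr].
Qed.

Lemma cannularX f : cannular f -> cannular (fun x => f x ^+ 2).
Proof. by move=> cf; apply: (cannularM cf.1 cf). Qed.

Lemma integrable_cannular f : cannular f -> leb3.-integrable setT (EFin \o f).
Proof. by move=> [cf /annular_boxed[b bf]]; exact: (integrable_boxed cf bf). Qed.

Lemma continuous_expR_nrm : continuous (fun x : R3 => expR (nrm x)).
Proof.
by move=> x; apply: continuous_comp; [exact: nrm_continuous|exact: continuous_expR].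
Qed.

Lemma continuous_expRN_nrm : continuous (fun x : R3 => expR (- nrm x)).
Proof.
move=> x; apply: (@continuous_comp _ _ _ (fun y => - nrm y) (@expR R)).
  by apply: cvgN; exact: nrm_continuous.
exact: continuous_expR.
Qed.

Section Pair.
Variables a b c d : R3 -> R.
Hypotheses (sa : smooth a) (sb : smooth b) (sc : smooth c) (sd : smooth d).
Hypotheses (aa : annular a) (ab : annular b) (ac : annular c) (ad : annular d).

Let cs f : smooth f -> annular f -> cannular f.
Proof. by move=> sf af; split=> //; exact/C1_continuous/smooth_C1. Qed.

Let cp j f : smooth f -> annular f -> cannular (partial j f).
Proof.
by move=> sf af; split; [exact/continuous_partial/smooth_C1|exact: annular_partial].
Qed.

Let cr i j f : smooth f -> annular f -> cannular (rot i j f).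
Proof.
by move=> sf af; split; [exact/C1_continuous/C1_rot|exact: annular_rot].
Qed.

Lemma cannular_sqr_spinor : cannular (sqr_spinor a b c d).
Proof.
have X f (sf : smooth f) (af : annular f) := cannularX (cs sf af).
exact: (cannularD (cannularD (cannularD (X _ sa aa) (X _ sb ab)) (X _ sc ac)) (X _ sd ad)).
Qed.

Lemma cannular_sqr_so : cannular (sqr_so a b c d).
Proof.
have ra i j := cr i j sa aa; have rb i j := cr i j sb ab.
have rc i j := cr i j sc ac; have rd i j := cr i j sd ad.
have c1 := cannularB (cannularD (rb 0 1) (rd 1 2)) (rc 2 0).
have c2 := cannularN (cannularD (cannularD (ra 0 1) (rc 1 2)) (rd 2 0)).
have c3 := cannularB (cannularD (rb 1 2) (ra 2 0)) (rd 0 1).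
have c4 := cannularN (cannularB (cannularB (ra 1 2) (rb 2 0)) (rc 0 1)).
have X f g (sf : smooth f) (af : annular f) cg := cannularX (@cannularD f g (cs sf af) cg).
exact: (cannularD (cannularD (cannularD (X _ _ sa aa c1) (X _ _ sb ab c2))
  (X _ _ sc ac c3)) (X _ _ sd ad c4)).
Qed.

Lemma cannular_sqr_weyl : cannular (sqr_weyl a b c d).
Proof.
have pa j := cp j sa aa; have pb j := cp j sb ab.
have pc j := cp j sc ac; have pd j := cp j sd ad.
have c1 := cannularX (cannularD (cannularD (pa 2) (pc 0)) (pd 1)).
have c2 := cannularX (cannularB (cannularD (pb 2) (pd 0)) (pc 1)).
have c3 := cannularX (cannularB (cannularB (pa 0) (pb 1)) (pc 2)).
have c4 := cannularX (cannularB (cannularD (pb 0) (pa 1)) (pd 2)).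
exact: (cannularD (cannularD (cannularD c1 c2) c3) c4).
Qed.

End Pair.

Lemma test_spinorP psi : test_spinor psi -> forall k,
  [/\ smooth (re_part psi k), smooth (im_part psi k),
      annular (re_part psi k) & annular (im_part psi k)].
Proof.
move=> [spsi [p [q [p0 psi0]]]] k; have [sr si] := spsi k; split => //; exists p, q;
  by split=> // x /psi0; rewrite /re_part /im_part => ->; rewrite mxE.
Qed.

Lemma ineqs_test_spinor psi : test_spinor psi ->
  ((expR 1 ^+ 2)%:E * I_L2 psi <= (expR 1 ^+ 2)%:E * I_SL psi)%E /\
  ((expR 1 ^+ 2)%:E * I_SL psi <= I_D psi)%E.
Proof.
move=> /test_spinorP tp.
have [s1 s2 a1 a2] := tp up0; have [s3 s4 a3 a4] := tp up1.
have [t1 t2 b1 b2] := tp dn0; have [t3 t4 b3 b4] := tp dn1.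
pose A x := expR (- nrm x) * norm2 (psi x).
pose B x := expR (- nrm x) * norm2 (spin_orbit_op psi x).
pose D x := expR (nrm x) * norm2 (Defs.dirac psi x).
have iA : leb3.-integrable setT (EFin \o A).
  apply: integrable_cannular; rewrite /A; under eq_fun do rewrite norm2_pauli.
  apply: cannularM; first exact: continuous_expRN_nrm.
  by apply: cannularD; exact: cannular_sqr_spinor.
have iB : leb3.-integrable setT (EFin \o B).
  apply: integrable_cannular; rewrite /B; under eq_fun do rewrite norm2_spin_orbit.
  apply: cannularM; first exact: continuous_expRN_nrm.
  by apply: cannularD; exact: cannular_sqr_so.
have iD : leb3.-integrable setT (EFin \o D).
  apply: integrable_cannular; rewrite /D; under eq_fun do rewrite norm2_dirac.
  apply: cannularM; first exact: continuous_expR_nrm.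
  by apply: cannularD; exact: cannular_sqr_weyl.
have -> : I_L2 psi = (\int[leb3]_x (A x)%:E)%E.
  by apply: eq_integral => x _; rewrite /A expRN mulrC.
have -> : I_SL psi = (\int[leb3]_x (B x)%:E)%E.
  by apply: eq_integral => x _; rewrite /B expRN mulrC.
have -> : I_D psi = (\int[leb3]_x (D x)%:E)%E.
  by apply: eq_integral => x _; rewrite /D mulrC.
split.
  rewrite lee_wpmul2l ?lee_fin ?sqr_ge0 //.
  have [n nn le1] := le_pauli_spin_orbit s1 s2 s3 s4 a1 a2 a3.
  have [m nm le2] := le_pauli_spin_orbit t1 t2 t3 t4 b1 b2 b3.
  apply: (le_integral_null iA iB (nullD nn nm)) => x.
  rewrite /A /B norm2_pauli norm2_spin_orbit; move: (le1 x) (le2 x).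
  move: (expR _) (n x) (m x) (sqr_spinor (re_part psi up0) _ _ _ x).
  move: (sqr_spinor (re_part psi dn0) _ _ _ x) (sqr_so (re_part psi up0) _ _ _ x).
  by move: (sqr_so (re_part psi dn0) _ _ _ x) => *; lra.
have := integralZl measurableT iB (expR 1 ^+ 2); rewrite /= => <-.
have [n nn le1] := le_spin_orbit_weyl s1 s2 s3 s4 a1 a2 a3 a4.
have [m nm le2] := le_spin_orbit_weyl t1 t2 t3 t4 b1 b2 b3 b4.
apply: (le_integral_null (integrableZl measurableT (expR 1 ^+ 2) iB) iD (nullD nn nm)) => x.
rewrite /B /D norm2_dirac norm2_spin_orbit; move: (le1 x) (le2 x).
move: (expR 1 ^+ 2) (expR (- nrm x)) (expR (nrm x)) (n x) (m x).
move: (sqr_weyl (re_part psi up0) _ _ _ x) (sqr_weyl (re_part psi dn0) _ _ _ x).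
move: (sqr_so (re_part psi up0) _ _ _ x) (sqr_so (re_part psi dn0) _ _ _ x) => *; lra.
Qed.

End TestSpinors.

(** * Finiteness of the integral of e^{-r} *)

Section ExponentialDecay.
Variable R : realType.
Local Notation R3 := (R3 R).
Local Notation leb3 := (@leb3 R).
Local Notation leb := (@lebesgue_measure R).
Local Open Scope classical_set_scope.

(** A product of three such functions, each with integral pi over the line, dominates e^{-r} up to a
    constant and replaces spherical coordinates. *)
Let h (t : R) : R := (oneDsqr t)^-1.

Let h_ge0 t : 0 <= h t. Proof. by rewrite invr_ge0 addr_ge0 ?sqr_ge0. Qed.

Let h_cont : continuous h. Proof. exact: continuous_oneDsqrV. Qed.

Let h_meas : measurable_fun setT (EFin \o h).
Proof. by apply/measurable_EFinP; exact: continuous_measurable_fun. Qed.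

Let integral_h : (\int[leb]_t (h t)%:E = pi%:E)%E.
Proof.
rewrite ge0_symfun_integralT //=.
  rewrite (_ : [set x | _] = `[0, +oo[%classic); last first.
    by apply/seteqP; split => x /=; rewrite in_itv /= andbT.
  by rewrite integral0y_oneDsqr -EFinM mulrCA divff // mulr1.
by move=> x /=; rewrite /h /oneDsqr sqrrN.
Qed.

Let integral_Zh (c : R) : 0 <= c -> (\int[leb]_t (c * h t)%:E = (pi * c)%:E)%E.
Proof.
move=> c0; transitivity (\int[leb]_t (c%:E * (EFin \o h) t))%E; first exact: eq_integral.
have -> := @ge0_integralZl_EFin _ _ R leb setT measurableT (EFin \o h)
  (fun t _ => h_ge0 t) h_meas c c0.
by rewrite integral_h -EFinM mulrC.
Qed.

Let hhh (x : R3) : R := h x.1.1 * h x.1.2 * h x.2.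

Let coord_cont : [/\ continuous (fun x : R3 => x.1.1), continuous (fun x : R3 => x.1.2)
  & continuous (fun x : R3 => x.2)].
Proof.
by have C j := C1_continuous (@C1_coord R j); split; [exact: (C 0)|exact: (C 1)|exact: (C 2)].
Qed.

Let hhh_cont : continuous hhh.
Proof.
have [c1 c2 c3] := coord_cont => x.
apply: cvgM; first apply: cvgM.
- by apply: (continuous_comp (c1 x)); exact: h_cont.
- by apply: (continuous_comp (c2 x)); exact: h_cont.
- by apply: (continuous_comp (c3 x)); exact: h_cont.
Qed.

Let integral_hhh : (\int[leb3]_x (hhh x)%:E = (pi ^+ 3)%:E)%E.
Proof.
have m3 : measurable_fun setT (EFin \o hhh).
  by apply/measurable_EFinP; exact: continuous_measurable3.
have p3 x : (0 <= (EFin \o hhh) x)%E by rewrite lee_fin !mulr_ge0.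
apply: etrans (@fubini_tonelli1 _ _ _ _ R (@leb2 R) leb _ m3 p3) _.
pose hh (u : R * R) : R := h u.1 * h u.2.
have m2 : measurable_fun setT (EFin \o hh).
  apply/measurable_EFinP; apply: measurable_funM.
    by apply: measurableT_comp measurable_fst; exact: continuous_measurable_fun.
  by apply: measurableT_comp measurable_snd; exact: continuous_measurable_fun.
have p2 (u : R * R) : (0 <= (hh u)%:E)%E by rewrite lee_fin mulr_ge0.
have pi0 : 0 <= pi :> R by exact: pi_ge0.
transitivity (\int[@leb2 R]_u (pi%:E * (EFin \o hh) u))%E.
  apply: eq_integral => u _; rewrite -[RHS]EFinM.
  exact: (@integral_Zh (hh u) (mulr_ge0 (h_ge0 _) (h_ge0 _))).
have -> := @ge0_integralZl_EFin _ _ R (@leb2 R) setT measurableT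
  (EFin \o hh) (fun u _ => p2 u) m2 pi pi0.
have -> : (\int[@leb2 R]_u (EFin \o hh) u = (pi * pi)%:E)%E.
  apply: etrans (@fubini_tonelli1 _ _ _ _ R leb leb _ m2 p2) _.
  transitivity (\int[leb]_t (pi * h t)%:E)%E; last exact: integral_Zh.
  by apply: eq_integral => u _; exact: (@integral_Zh (h u) (h_ge0 _)).
by rewrite -EFinM !exprS expr0 mulr1.
Qed.

(* exp (-r) <= (1 + r / 6)^-6 <= 36^3 (1 + r^2)^-3 *)
Let expRN_nrm_le x : expR (- nrm x) <= 36 ^+ 3 * hhh x.
Proof.
have r0 := nrm_ge0 x; set r := nrm x in r0 *.
(* Each factor is at most 1 + r^2 <= (6 + r)^2; three quadratic factors account for the exponent
   6. *)
have D j : 1 + Defs.coord x j ^+ 2 <= 36 * (1 + r / 6) ^+ 2.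
  have : Defs.coord x j ^+ 2 <= r ^+ 2.
    by rewrite -real_normK ?num_real // ler_pXn2r ?nnegrE // ler_coord_nrm.
  by move=> h1; have := r0; nra.
have E : (1 + r / 6) ^+ 6 <= expR r.
  have -> : expR r = expR (r / 6) ^+ 6.
    by rewrite !exprS expr0 mulr1 -!expRD; congr expR; field.
  by apply: lerXn2r; rewrite ?nnegrE ?expR_ge0 ?expR_ge1Dx // addr_ge0 ?divr_ge0.
have p j : 0 < 1 + Defs.coord x j ^+ 2 by rewrite ltr_pwDl // sqr_ge0.
rewrite expRN /hhh /h /oneDsqr -!invfM -[36 ^+ 3]invrK -invfM.
rewrite lef_pV2 ?posrE ?expR_gt0 //; last first.
  by rewrite mulr_gt0 ?invr_gt0 // ?mulr_gt0 //; [exact: (p 0)|exact: (p 1)|exact: (p 2)].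
apply: le_trans E; rewrite ler_pdivrMl //.
rewrite (_ : 36 ^+ 3 * _ = (36 * (1 + r / 6) ^+ 2) * (36 * (1 + r / 6) ^+ 2)
  * (36 * (1 + r / 6) ^+ 2)); last by ring.
apply: ler_pM; [|exact: ltW (p 2)|apply: ler_pM|exact: (D 2)].
- by rewrite mulr_ge0 // ltW //; [exact: (p 0)|exact: (p 1)].
- exact: ltW (p 0).
- exact: ltW (p 1).
- exact: (D 0).
- exact: (D 1).
Qed.

Lemma integral_expRN_nrm : (\int[leb3]_x (expR (- nrm x))%:E < +oo)%E.
Proof.
have mh : measurable_fun setT (EFin \o hhh).
  by apply/measurable_EFinP; exact: continuous_measurable3.
have me : measurable_fun setT (EFin \o (fun x : R3 => expR (- nrm x))).
  by apply/measurable_EFinP; exact: (continuous_measurable3 (@continuous_expRN_nrm R)).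
apply: (@le_lt_trans _ _ (\int[leb3]_x ((36 ^+ 3)%:E * (hhh x)%:E))%E).
  apply: ge0_le_integral; first by [].
  - by move=> x _; rewrite lee_fin expR_ge0.
  - exact: me.
  - exact: (measurable_funeM _ mh).
  - by move=> x _; rewrite -EFinM lee_fin expRN_nrm_le.
have c0 : 0 <= 36 ^+ 3 :> R by rewrite exprn_ge0.
have h0 x : (setT : set R3) x -> (0 <= (hhh x)%:E)%E.
  by move=> _; rewrite lee_fin !mulr_ge0.
have -> := @ge0_integralZl_EFin _ _ R leb3 setT measurableT (EFin \o hhh) h0 mh _ c0.
by rewrite integral_hhh -EFinM ltry.
Qed.

End ExponentialDecay.

(** * Essential bounds *)

Section AlmostEverywhere.
Variable R : realType.
Local Notation R3 := (R3 R).
Local Notation leb3 := (@leb3 R).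
Local Notation leb := (@lebesgue_measure R).
Local Open Scope classical_set_scope.

Let leb3_prod (A B C : set R) : measurable A -> measurable B -> measurable C ->
  leb3 ((A `*` B) `*` C) = (leb A * leb B * leb C)%E.
Proof.
move=> mA mB mC; transitivity (leb2 (A `*` B) * leb C)%E.
  by apply: (@product_measure1E _ _ _ _ R (@leb2 R) leb) => //; exact: measurableX.
by congr (_ * _)%E; exact: product_measure1E.
Qed.

(** A ball here is a cube of positive volume, so no null set contains it. *)
Lemma ae_in_ball (P : R3 -> Prop) (p : R3) (e : R) :
  {ae leb3, forall x, P x} -> 0 < e -> exists2 x, ball p e x & P x.
Proof.
move=> [N [mN N0 PN]] e0; apply: contrapT => nP.
have bN : (ball p.1.1 e `*` ball p.1.2 e) `*` ball p.2 e `<=` N.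
  by move=> x [[b1 b2] b3]; apply: PN => Px; apply: nP; exists x.
have mb (t : R) : measurable (ball t e) by rewrite ball_itv; exact: measurable_itv.
have : (leb3 ((ball p.1.1 e `*` ball p.1.2 e) `*` ball p.2 e) <= 0)%E.
  rewrite -N0; apply: le_measure => //; rewrite inE //.
  by apply: measurableX; [apply: measurableX|]; exact: mb.
rewrite leb3_prod // !lebesgue_measure_ball ?(ltW e0) // -!EFinM lee_fin leNgt.
by rewrite !mulr_gt0 // mulrn_wgt0.
Qed.

Lemma negligible_nrm0 : leb3.-negligible [set x : R3 | nrm x = 0].
Proof.
exists (([set 0] `*` [set 0]) `*` [set 0]); split.
- by apply: measurableX => //; exact: measurableX.
- by rewrite leb3_prod // lebesgue_measure_set1 mule0.
- move=> x /= x0; have c j : Defs.coord x j = 0.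
    by apply/eqP; rewrite -normr_le0 -x0; exact: ler_coord_nrm.
  by split; [split|]; [exact: (c 0)|exact: (c 1)|exact: (c 2)].
Qed.

Lemma nrm_eq0 (x : R3) : nrm x = 0 -> x = (0, 0, 0).
Proof.
move=> x0; have c j : Defs.coord x j = 0.
  by apply/eqP; rewrite -normr_le0 -x0; exact: ler_coord_nrm.
by case: x c {x0} => [[x y] z] c; congr (_, _, _); [exact: (c 0)|exact: (c 1)|exact: (c 2)].
Qed.

Lemma ess_sup_cst0 (f : R3 -> \bar R) : (forall x, f x = 0%E) -> ess_sup leb3 f = 0%E.
Proof.
move=> f0; apply/eqP; rewrite eq_le; apply/andP; split.
  by apply: ereal_inf_lbound; apply/aeW => x; rewrite f0.
apply: le_ereal_inf_tmp => y /= fy.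
by have [x _] := ae_in_ball (0 : R3) fy ltr01; rewrite f0.
Qed.

Lemma ess_inf_expR_nrm :
  ess_inf leb3 (fun x => (expR (nrm x) / nrm x)%:E) = (expR 1)%:E.
Proof.
apply/eqP; rewrite eq_le; apply/andP; split; last first.
  (* The origin has to be discarded: there 1/0 = 0 makes the quotient 0, below e. *)
  apply: ereal_sup_ubound => /=; have [N [mN N0 sN]] := negligible_nrm0.
  exists N; split=> // x /= nx; apply: sN => /=; apply: contrapT => /eqP x0; apply: nx.
  have r0 : 0 < nrm x by rewrite lt_neqAle eq_sym x0 nrm_ge0.
  have := expR1_ler r0; rewrite lee_fin expRN ler_pdivlMr //.
  rewrite ler_pdivrMr ?expR_gt0 // => h.
  rewrite -ler_pdivlMr //; apply: le_trans h _; by rewrite mulrC.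
apply: ge_ereal_sup => y /= fy; rewrite leNgt; apply/negP => ey.
(* A point of the unit sphere, where e^r / r attains its minimum; continuity keeps the quotient
   below any larger number near [p]. *)
pose p : R3 := (1, 0, 0); have p1 : nrm p = 1.
  by rewrite /nrm /= expr1n expr0n /= !addr0 sqrtr1.
have cf : {for p, continuous (fun x : R3 => expR (nrm x) / nrm x)}.
  apply: cvgM; first exact: continuous_expR_nrm.
  by apply: cvgV; [rewrite p1 oner_eq0|exact: nrm_continuous].
(* [y] may be +oo, so a real threshold above e is chosen below it. *)
have [z ez zy] : exists2 z : R, expR 1 < z & (z%:E <= y)%E.
  case: y ey {fy} => [y|_|//]; last by exists (expR 1 + 1); rewrite ?ltrDl ?leey.
  by rewrite lte_fin => ey; exists y.
have : \forall x \near p, expR (nrm x) / nrm x < z.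
  by apply: (cvgr_lt _ cf); rewrite p1 divr1.
move=> /nbhs_ballP[e /= e0 He].
have [x /He xz yx] := ae_in_ball p fy e0.
by have := le_trans zy yx; rewrite lee_fin leNgt xz.
Qed.

End AlmostEverywhere.

(** * Equality for the extremal spinors *)

Section Extremal.
Variable R : realType.
Local Notation R3 := (R3 R).
Local Notation leb3 := (@leb3 R).
Local Open Scope classical_set_scope.

(** A solution of F' = - e^{1-r} F, which is exactly the vanishing of the square in
    [sqr_radial_bound] when chi is radial and K chi = chi. *)
Let F (r : R) : R := expR (expR (1 - r)).
Let dF (r : R) : R := - expR (1 - r) * F r.

Let is_derive_F (r : R) : is_derive r 1 F (dF r).
Proof.
have d1 : is_derive r 1 (fun s : R => 1 - s) (-1).
  have := is_deriveB (is_derive_cst (1 : R) r 1) (is_derive_id r 1).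
  by rewrite sub0r.
have d2 := @is_derive1_comp _ (@expR R) (fun s => 1 - s) _ _ _ (is_derive_expR (1 - r)) d1.
have := @is_derive1_comp _ (@expR R) (fun s => expR (1 - s)) _ _ _
  (is_derive_expR (expR (1 - r))) d2.
by rewrite (_ : _ * _ = dF r) // /dF /F; ring.
Qed.

Variable v : 'cV[R]_4.

Lemma re_psi0 k : re_part (psi0 v) k = fun x => v k 0 * F (nrm x).
Proof. by apply/funext => x; rewrite /re_part mxE. Qed.

Lemma im_psi0 k : im_part (psi0 v) k = cst 0.
Proof. by apply/funext => x; rewrite /im_part mxE. Qed.

Let partial_re j k (x : R3) : 0 < nrm x ->
  partial j (re_part (psi0 v) k) x = v k 0 * (dF (nrm x) * (Defs.coord x j / nrm x)).
Proof.
move=> x0; rewrite re_psi0 /partial derive1E.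
have d0 : is_derive (nrm (upd x j (Defs.coord x j))) 1 F (dF (nrm x)).
  by rewrite upd_coord; exact: is_derive_F.
have d1 := @is_derive1_comp _ F (fun t => nrm (upd x j t)) _ _ _ d0 (is_derive_nrm j x0).
by have [_ E] := is_deriveZ (v k 0) d1; apply: etrans E _.
Qed.

(** Rotations kill radial functions. At the origin the coordinates vanish, whatever value the
    derivatives take. *)
Let rot_re i j k x : rot i j (re_part (psi0 v) k) x = 0.
Proof.
have [x0|x0] := eqVneq (nrm x) 0.
  exact: rot_nrm0.
have r0 : 0 < nrm x by rewrite lt_neqAle eq_sym x0 nrm_ge0.
rewrite /rot (partial_re i k r0) (partial_re j k r0).
by move: (Defs.coord x i) (Defs.coord x j) (dF _) (nrm x)^-1 => *; ring.
Qed.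

Let rot_im i j k x : rot i j (im_part (psi0 v) k) x = 0.
Proof. by rewrite im_psi0 /rot !partial_cst !mulr0 subrr. Qed.

Let V := v up0 0 ^+ 2 + v up1 0 ^+ 2 + (v dn0 0 ^+ 2 + v dn1 0 ^+ 2).

Lemma norm2_psi0 x : norm2 (psi0 v x) = V * F (nrm x) ^+ 2.
Proof.
by rewrite norm2_pauli /sqr_spinor !re_psi0 !im_psi0 /V /cst /=; ring.
Qed.

Lemma norm2_spin_orbit_psi0 x : norm2 (spin_orbit_op (psi0 v) x) = norm2 (psi0 v x).
Proof.
rewrite norm2_spin_orbit norm2_pauli /sqr_so /so1 /so2 /so3 /so4 !rot_re !rot_im.
by rewrite !(addr0, subr0, oppr0).
Qed.

(** On a radial spinor sigma.nabla is (sigma.x) / r, a unitary matrix, times the radial derivative.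
    The profile generally has a cone-like singularity at the origin. *)
Lemma norm2_dirac_psi0 x : 0 < nrm x ->
  norm2 (Defs.dirac (psi0 v) x) = expR (1 - nrm x) ^+ 2 * norm2 (psi0 v x).
Proof.
move=> x0; rewrite norm2_psi0 norm2_dirac /sqr_weyl /weyl1 /weyl2 /weyl3 /weyl4.
rewrite !im_psi0 !partial_cst !(partial_re _ _ x0).
have r0 : nrm x != 0 by rewrite gt_eqF.
have /eqP : nrm x ^+ 2 = Defs.coord x 0 ^+ 2 + Defs.coord x 1 ^+ 2 + Defs.coord x 2 ^+ 2.
  by rewrite nrm_sqr /sqnrm !expr2.
rewrite /dF /V; move: (v up0 0) (v up1 0) (v dn0 0) (v dn1 0) => p q s t.
move: (Defs.coord x 0) (Defs.coord x 1) (Defs.coord x 2) => x1 x2 x3.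
move: (nrm x) (expR (1 - nrm x)) (F (nrm x)) r0 => r e f r0 /eqP r2.
transitivity (e ^+ 2 * f ^+ 2 * (p ^+ 2 + q ^+ 2 + (s ^+ 2 + t ^+ 2))
  * ((x1 ^+ 2 + x2 ^+ 2 + x3 ^+ 2) / r ^+ 2)); first by field.
by rewrite -r2; field.
Qed.

Let g x := norm2 (psi0 v x) / expR (nrm x).

Let V_ge0 : 0 <= V. Proof. by rewrite !addr_ge0 // sqr_ge0. Qed.

Let g_ge0 x : 0 <= g x.
Proof. by rewrite /g norm2_psi0 divr_ge0 ?expR_ge0 // mulr_ge0 ?sqr_ge0. Qed.

Let g_le x : g x <= V * F 0 ^+ 2 * expR (- nrm x).
Proof.
rewrite /g norm2_psi0 expRN ler_wpM2r ?invr_ge0 ?expR_ge0 // ler_wpM2l //.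
(* [F] is decreasing, so F(0) bounds it. *)
by apply: lerXn2r; rewrite ?nnegrE ?expR_ge0 // !ler_expR lerD2l lerN2 nrm_ge0.
Qed.

Let g_meas : measurable_fun setT (g : (measurableTypeR R * measurableTypeR R * measurableTypeR R) -> R).
Proof.
apply: continuous_measurable3 => x.
rewrite /g; under eq_fun do rewrite norm2_psi0 -expRN.
apply: cvgM; last exact: continuous_expRN_nrm.
apply: cvgM; first exact: cvg_cst.
have cFn : F (nrm y) @[y --> x] --> F (nrm x).
  apply: (continuous_comp (@nrm_continuous R x)).
  have [/derivable1_diffP dd _] := is_derive_F (nrm x).
  exact: differentiable_continuous dd.
by under eq_fun do rewrite expr2; rewrite expr2; exact: cvgM.
Qed.

Let integral_g : (\int[leb3]_x (g x)%:E < +oo)%E.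
Proof.
have c0 : 0 <= V * F 0 ^+ 2 by rewrite mulr_ge0 ?sqr_ge0.
have me : measurable_fun setT (EFin \o (fun x : R3 => expR (- nrm x))).
  by apply/measurable_EFinP; exact: (continuous_measurable3 (@continuous_expRN_nrm R)).
have e0 (x : R3) : setT x -> (0 <= (EFin \o (fun x : R3 => expR (- nrm x))) x)%E.
  by move=> _; rewrite lee_fin expR_ge0.
have h : (\int[leb3]_x (g x)%:E <=
    \int[leb3]_x ((V * F 0 ^+ 2)%:E * (EFin \o (fun x : R3 => expR (- nrm x))) x))%E.
  apply: ge0_le_integral; first by [].
  - by move=> x _; rewrite lee_fin.
  - by apply/measurable_EFinP; exact: g_meas.
  - exact: (measurable_funeM _ me).
  - by move=> x _; rewrite -EFinM lee_fin.
apply: le_lt_trans h _.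
rewrite [X in (X < _)%E](@ge0_integralZl_EFin _ _ R leb3 setT measurableT _ e0 me _ c0).
by rewrite lte_mul_pinfty // ?lee_fin //; exact: integral_expRN_nrm.
Qed.

Lemma psi0_extremal : (I_D (psi0 v) < +oo)%E /\
  ((expR 1 ^+ 2)%:E * I_L2 (psi0 v) = (expR 1 ^+ 2)%:E * I_SL (psi0 v))%E /\
  ((expR 1 ^+ 2)%:E * I_SL (psi0 v) = I_D (psi0 v))%E.
Proof.
have L2 : I_L2 (psi0 v) = (\int[leb3]_x (g x)%:E)%E by [].
have SL : I_SL (psi0 v) = (\int[leb3]_x (g x)%:E)%E.
  by apply: eq_integral => x _; rewrite norm2_spin_orbit_psi0.
have c0 : 0 <= expR 1 ^+ 2 :> R by exact: sqr_ge0.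
have mg : measurable_fun setT (EFin \o g) by apply/measurable_EFinP; exact: g_meas.
have eg0 (x : R3) : setT x -> (0 <= (EFin \o g) x)%E by move=> _; rewrite lee_fin.
pose D x := norm2 (Defs.dirac (psi0 v) x) * expR (nrm x).
have DE x : 0 < nrm x -> D x = expR 1 ^+ 2 * g x.
  move=> x0; rewrite /D /g norm2_dirac_psi0 // expRD expRN.
  by field; rewrite gt_eqF ?expR_gt0.
have D_ge0 x : 0 <= D x.
  rewrite /D mulr_ge0 ?expR_ge0 // norm2_dirac.
  by rewrite /sqr_weyl !addr_ge0 ?sqr_ge0.
have DI : I_D (psi0 v) = ((expR 1 ^+ 2)%:E * \int[leb3]_x (g x)%:E)%E.
  have <- := @ge0_integralZl_EFin _ _ R leb3 setT measurableT _ eg0 mg _ c0.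
  apply: ge0_ae_eq_integral => //.
  (* At the origin [D] involves derivatives that need not exist; isolating that single value gives
     measurability. *)
  - apply/measurable_EFinP; rewrite [X in measurable_fun _ X](_ : _ =
      fun x => if nrm x == 0 then D (0, 0, 0) else expR 1 ^+ 2 * g x); last first.
      apply/funext => x; have [x0|x0] := eqVneq (nrm x) 0; first by rewrite (nrm_eq0 x0).
      by apply: DE; rewrite lt_neqAle eq_sym x0 nrm_ge0.
    apply: measurable_fun_ifT => //.
      apply: measurable_fun_eqr; last exact: measurable_cst.
      exact: (continuous_measurable3 (@nrm_continuous R)).
    by apply: measurable_funM; [exact: measurable_cst|exact: g_meas].
  - exact: (measurable_funeM _ mg).
  - by move=> x _; rewrite lee_fin D_ge0.
  - by move=> x _; rewrite -EFinM lee_fin mulr_ge0.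
  - have [N [mN N0 sN]] := negligible_nrm0 R; exists N; split => // x /= nx.
    apply: sN => /=; apply: contrapT => /eqP x0; apply: nx => _.
    by rewrite -EFinM -DE // lt_neqAle eq_sym x0 nrm_ge0.
rewrite L2 SL DI; split=> //.
by rewrite lte_mul_pinfty // ?lee_fin //; exact: integral_g.
Qed.

End Extremal.

Theorem theorem2p3 (R : realType) :
  ess_sup (@leb3 R)
    (fun x => (`| (radial (@omega_w R) x * eta_w x - omega_w x * radial (@eta_w R) x)
                  / omega_w x |)%:E) = 0%E
  /\ ess_inf (@leb3 R) (fun x => (eta_w x / nrm x)%:E) = (expR 1)%:E
  /\ (forall psi : spinor R, test_spinor psi ->
        ((expR 1 ^+ 2)%:E * I_L2 psi <= (expR 1 ^+ 2)%:E * I_SL psi)%E /\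
        ((expR 1 ^+ 2)%:E * I_SL psi <= I_D psi)%E)
  /\ (forall v : 'cV[R]_4,
        (I_D (psi0 v) < +oo)%E /\
        ((expR 1 ^+ 2)%:E * I_L2 (psi0 v) = (expR 1 ^+ 2)%:E * I_SL (psi0 v))%E /\
        ((expR 1 ^+ 2)%:E * I_SL (psi0 v) = I_D (psi0 v))%E).
Proof.
split; [|split; [exact: ess_inf_expR_nrm|split]].
(* Both weights are the same function, so the numerator cancels at every point without computing a
   radial derivative. *)
- apply: ess_sup_cst0 => x; rewrite -[@omega_w R]/(@eta_w R).
  by rewrite [X in X - _]mulrC subrr mul0r normr0.
- exact: ineqs_test_spinor.
- exact: psi0_extremal.
Qed.
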